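(* The entire function \[ F(z)=\sum_{n\ge 0}(\cos\sqrt n+2)\,\frac{z^n}{n!} \] can be written in the form $F(z)=e^zG(z)$, where $G$ is an entire function of order $\tfrac12$ and mean type. Consequently $n_F(R)=O(\sqrt R)$ as $R\to\infty$, although $F$ is not an exponential function (i.e., not of the form $\Theta e^{\alpha z}$ with $\Theta,\alpha\in\mathbb C$).
   Context: For an entire function $G$, put $M_G(R)=\max_{|z|=R}|G(z)|$. ''Order $\tfrac12$ and mean type'' means $0<\limsup_{R\to\infty}R^{-1/2}\log M_G(R)<\infty$. For an entire function $F$, $n_F(R)$ denotes the number of zeroes of $F$ in the closed disk $\{|z|\le R\}$, counted with multiplicities. *)

(* Defs.v *)
From Stdlib Require Import Reals List Factorial.
From Coquelicot Require Import Coquelicot.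

Local Open Scope R_scope.

Definition Cexp (z : C) : C :=
  (exp (Re z) * cos (Im z), exp (Re z) * sin (Im z)).

(* Complex differentiability: the derivative is taken over [C_AbsRing]. *)
Definition entire (G : C -> C) : Prop :=
  forall z : C, ex_derive (K := C_AbsRing) (V := C_NormedModule) G z.

(* Complex counterpart of [PSeries], which exists only over [R]; the value is
   arbitrary where the series diverges. *)
Definition CPSeries (a : nat -> C) (z : C) : C :=
  iota (T := C_CompleteNormedModule)
    (fun l : C => is_pseries (K := C_AbsRing) (V := C_NormedModule) a z l).

(* The supremum is attained when [G] is continuous and [0 <= r], since the
   circle is then compact and nonempty. *)
Definition max_modulus (G : C -> C) (r : R) : R :=
  real (Lub_Rbar (fun y : R => exists z : C, Cmod z = r /\ y = Cmod (G z))).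

(* Limsup of [f] at [+oo]: the infimum over [r] of the supremum of [f] over
   [r, +oo). *)
Definition limsup_infty (f : R -> R) : Rbar :=
  Rbar_glb (fun s : Rbar => exists r : R,
    s = Lub_Rbar (fun y : R => exists x : R, r <= x /\ y = f x)).

Definition order_half_mean_type (G : C -> C) : Prop :=
  let s := limsup_infty (fun r : R => / sqrt r * ln (max_modulus G r)) in
  Rbar_lt 0 s /\ Rbar_lt s p_infty.

(* [F] vanishes at [a] to order exactly [m]; [m = 0] means that [F] is entire
   and [F a <> 0]. *)
Definition vanishing_order (F : C -> C) (a : C) (m : nat) : Prop :=
  exists H : C -> C, entire H /\ H a <> RtoC 0 /\
    forall z : C, F z = Cmult (Cpow (Cminus z a) m) (H z).

(* [F] has exactly [n] zeroes in the closed disk of radius [r], counted with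
   multiplicities: [l] lists them, each repeated according to its
   multiplicity.  At most one [n] satisfies this. *)
Definition zero_count (F : C -> C) (r : R) (n : nat) : Prop :=
  exists l : list C, length l = n /\
    forall z : C,
      (Cmod z <= r -> vanishing_order F z (count_occ Ceq_dec l z)) /\
      (r < Cmod z -> ~ In z l).

Definition F_coef (n : nat) : C :=
  RtoC ((cos (sqrt (INR n)) + 2) / INR (fact n)).

Definition F : C -> C := CPSeries F_coef.

(* Main.v *)
Require Import Defs.
From Stdlib Require Import Reals List Factorial Lra Lia Classical ClassicalEpsilon.
From Coquelicot Require Import Coquelicot.
Local Open Scope R_scope.

(* Write a_m = (-1)^m / (2m)!, so that cos (sqrt n) = sum_m a_m n^m, and let
   S(m, k) be the Stirling numbers of the second kind. Expanding n^m in falling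
   factorials gives cos (sqrt n) / n! = sum_(k <= n) c_k / (n - k)! with
   c_k = sum_m a_m S(m, k), i.e. F = e^z G with G = 2 + sum_k c_k z^k. Since
   S(k + j, k) <= (k (k + 1) / 2)^j, the leading term a_k dominates:
   |c_k - a_k| <= |a_k| / 7. Hence |G z| <= 4 cosh (sqrt |z|), while on the
   negative axis |G (- r)| >= (6/7) cosh (sqrt r).

   Zeros: if G = (z - a_1) ... (z - a_n) g with all |a_i| <= r, then the maximum
   principle for g on |z| = 4r gives |G 0| 3^n <= max_(|z| = 4r) |G|, so that
   n = O(sqrt r). *)

(** * Complex power series *)

(** All analysis is carried out on Taylor coefficients. Dividing by z - z0 is an operation on
    coefficient sequences; it gives complex differentiability when applied twice and the splitting
    off of a zero when applied once. The maximum principle is wanted only at the centre of a disk,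
    where an average over roots of unity provides it. The passage from n^m to the c_k rearranges no
    infinite double sum: for fixed n only the indices k <= n occur, so finitely many convergent
    series are added. Zeros are counted on G rather than on F: e^z has none, and the growth of F
    itself, of the size e^r, would give only O(r). The summand 2 changes c_0 alone; it has the sign
    of a_0, so it creates no cancellation on the negative axis, and it keeps G 0 away from 0. *)

Local Notation is_Cseries := (is_series (K := C_AbsRing) (V := C_NormedModule)).

Lemma pow_n_Cpow (z : C) (k : nat) : pow_n (K := C_Ring) z k = Cpow z k.
Proof. induction k as [|k IH]; [reflexivity|]. simpl pow_n. rewrite IH. reflexivity. Qed.

Definition Csum_n (u : nat -> C) (n : nat) : C := sum_n (G := C_AbelianMonoid) u n.

Lemma Csum_n_O (u : nat -> C) : Csum_n u 0 = u O.
Proof. exact (sum_O (G := C_AbelianMonoid) u). Qed.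

Lemma Csum_n_Sn (u : nat -> C) (n : nat) : Csum_n u (S n) = Cplus (Csum_n u n) (u (S n)).
Proof. exact (sum_Sn (G := C_AbelianMonoid) u n). Qed.

Lemma Re_Csum_n (u : nat -> C) (N : nat) : Re (Csum_n u N) = sum_n (fun n => Re (u n)) N.
Proof.
  induction N as [|N IH]; [now rewrite Csum_n_O, sum_O|].
  rewrite Csum_n_Sn, sum_Sn, <- IH. reflexivity.
Qed.

Lemma Im_Csum_n (u : nat -> C) (N : nat) : Im (Csum_n u N) = sum_n (fun n => Im (u n)) N.
Proof.
  induction N as [|N IH]; [now rewrite Csum_n_O, sum_O|].
  rewrite Csum_n_Sn, sum_Sn, <- IH. reflexivity.
Qed.

(** Balls of [C] are products of balls of the components. This makes the real theory of series, in
    particular that of Cauchy products, available over [C]. *)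
Lemma is_Cseries_components (u : nat -> C) (l : C) :
  is_Cseries u l <->
  is_series (fun n => Re (u n)) (Re l) /\ is_series (fun n => Im (u n)) (Im l).
Proof.
  split.
  - intros H; split; intros P HP.
    + destruct HP as [e He].
      assert (Q : locally (T := C_UniformSpace) l (fun z => P (Re z))).
      { exists e. intros z [Hz _]. apply He, Hz. }
      specialize (H _ Q). destruct H as [N HN]. exists N. intros n Hn.
      rewrite <- Re_Csum_n. unfold Csum_n. apply HN, Hn.
    + destruct HP as [e He].
      assert (Q : locally (T := C_UniformSpace) l (fun z => P (Im z))).
      { exists e. intros z [_ Hz]. apply He, Hz. }
      specialize (H _ Q). destruct H as [N HN]. exists N. intros n Hn.
      rewrite <- Im_Csum_n. unfold Csum_n. apply HN, Hn.
  - intros [H1 H2] P [e He].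
    assert (Q1 : locally (T := R_UniformSpace) (Re l) (ball (Re l) e)) by now exists e.
    assert (Q2 : locally (T := R_UniformSpace) (Im l) (ball (Im l) e)) by now exists e.
    destruct (H1 _ Q1) as [N1 HN1]. destruct (H2 _ Q2) as [N2 HN2].
    exists (max N1 N2). intros n Hn. apply He. split.
    + change (ball (Re l) e (Re (Csum_n u n))). rewrite Re_Csum_n. apply HN1. lia.
    + change (ball (Im l) e (Im (Csum_n u n))). rewrite Im_Csum_n. apply HN2. lia.
Qed.

Lemma is_Cseries_unique (u : nat -> C) (l1 l2 : C) :
  is_Cseries u l1 -> is_Cseries u l2 -> l1 = l2.
Proof. intros H1 H2. exact (filterlim_locally_unique _ _ _ H1 H2). Qed.

Lemma ex_Cseries_le (u : nat -> C) (v : nat -> R) :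
  (forall n, Cmod (u n) <= v n) -> ex_series v -> exists l, is_Cseries u l.
Proof.
  intros H Hv.
  exact (ex_series_le (K := C_AbsRing) (V := C_CompleteNormedModule) u v H Hv).
Qed.

Lemma is_Cseries_Cmod_le (u : nat -> C) (v : nat -> R) (l : C) (L : R) :
  (forall n, Cmod (u n) <= v n) -> is_Cseries u l -> is_series v L -> Cmod l <= L.
Proof.
  intros Huv Hu Hv.
  assert (H1 : filterlim (fun N => Cmod (Csum_n u N)) eventually (Rbar_locally (Cmod l))).
  { exact (filterlim_comp _ _ _ _ _ _ _ _ Hu (filterlim_norm (V := C_NormedModule) l)). }
  assert (H2 : filterlim (fun N => sum_n v N) eventually (Rbar_locally L)) by exact Hv.
  apply (filterlim_le _ _ (Finite (Cmod l)) (Finite L)) with (2 := H1) (3 := H2).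
  exists O. intros n _.
  eapply Rle_trans; [exact (norm_sum_n_m (V := C_NormedModule) u 0 n)|].
  apply sum_n_m_le, Huv.
Qed.

(** Four real Cauchy products, one for each pair of real and imaginary parts; the hypotheses on
    [Cmod] make all of them absolutely convergent. *)
Lemma is_Cseries_mult (a b : nat -> C) (la lb : C) :
  is_Cseries a la -> is_Cseries b lb ->
  ex_series (fun n => Cmod (a n)) -> ex_series (fun n => Cmod (b n)) ->
  is_Cseries (fun n => Csum_n (fun k => Cmult (a k) (b (n - k)%nat)) n) (Cmult la lb).
Proof.
  intros Ha Hb Na Nb.
  assert (Abs : forall u : nat -> C, ex_series (fun n => Cmod (u n)) ->
     ex_series (fun n => Rabs (Re (u n))) /\ ex_series (fun n => Rabs (Im (u n)))).
  { intros u Hu; split; refine (ex_series_le (K := R_AbsRing) (V := R_CompleteNormedModule) _ _ _ Hu); intros n.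
    - change (Rabs (Rabs (Re (u n))) <= Cmod (u n)). rewrite Rabs_Rabsolu. apply re_le_Cmod.
    - change (Rabs (Rabs (Im (u n))) <= Cmod (u n)). rewrite Rabs_Rabsolu.
      eapply Rle_trans; [apply Rmax_r | apply Rmax_Cmod]. }
  destruct (Abs a Na) as [Na1 Na2]. destruct (Abs b Nb) as [Nb1 Nb2].
  apply is_Cseries_components in Ha. apply is_Cseries_components in Hb.
  destruct Ha as [Ha1 Ha2], Hb as [Hb1 Hb2].
  apply is_Cseries_components. split.
  - eapply is_series_ext; [| exact (is_series_minus _ _ _ _ (is_series_mult _ _ _ _ Ha1 Hb1 Na1 Nb1)
       (is_series_mult _ _ _ _ Ha2 Hb2 Na2 Nb2))].
    intros n. rewrite Re_Csum_n, sum_n_Reals. symmetry. apply minus_sum.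
  - eapply is_series_ext; [| exact (is_series_plus _ _ _ _ (is_series_mult _ _ _ _ Ha1 Hb2 Na1 Nb2)
       (is_series_mult _ _ _ _ Ha2 Hb1 Na2 Nb1))].
    intros n. rewrite Im_Csum_n, <- !sum_n_Reals. rewrite <- sum_n_plus. apply sum_n_ext.
    intros k. reflexivity.
Qed.

(** * Power series with infinite radius of convergence *)

Definition rapid (a : nat -> C) : Prop :=
  forall r : R, 0 < r -> exists M : R, forall k : nat, Cmod (a k) * r ^ k <= M.

Lemma is_series_half_geom (M : R) : is_series (fun k => M * (1 / 2) ^ k) (M * 2).
Proof.
  replace (M * 2) with (M * / (1 - 1 / 2)) by (f_equal; lra).
  apply (is_series_scal_l (K := R_AbsRing) (V := R_NormedModule) M), is_series_geom.
  rewrite Rabs_pos_eq; lra.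
Qed.

(** Boundedness of the terms at radius 2r leaves the factor (1/2)^k at radius r, which gives a
    geometric majorant uniform on the disk. *)
Lemma rapid_term_le (a : nat -> C) (r : R) :
  rapid a -> 0 < r ->
  exists M : R, 0 <= M /\ forall k z, Cmod z <= r -> Cmod (Cmult (a k) (Cpow z k)) <= M * (1 / 2) ^ k.
Proof.
  intros Ha Hr. destruct (Ha (2 * r)) as [M HM]; [lra|]. exists M. split.
  - generalize (HM O) (Cmod_ge_0 (a O)). simpl. lra.
  - intros k z Hz. rewrite Cmod_mult, Cmod_pow.
    apply Rle_trans with (Cmod (a k) * r ^ k).
    + apply Rmult_le_compat_l; [apply Cmod_ge_0|]. apply pow_incr.
      split; [apply Cmod_ge_0|exact Hz].
    + replace (Cmod (a k) * r ^ k) with (Cmod (a k) * (2 * r) ^ k * (1 / 2) ^ k).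
      * apply Rmult_le_compat_r; [apply pow_le; lra | apply HM].
      * rewrite Rpow_mult_distr, Rmult_assoc. f_equal.
        rewrite Rmult_comm, <- Rmult_assoc, <- Rpow_mult_distr.
        replace (1 / 2 * 2) with 1 by lra. rewrite pow1. ring.
Qed.

Lemma rapid_ex_series_Cmod (a : nat -> C) (z : C) :
  rapid a -> ex_series (fun k => Cmod (Cmult (a k) (Cpow z k))).
Proof.
  intros Ha.
  destruct (rapid_term_le a (Cmod z + 1) Ha) as [M [_ HM]]; [generalize (Cmod_ge_0 z); lra|].
  refine (ex_series_le (K := R_AbsRing) (V := R_CompleteNormedModule) _ (fun k => M * (1 / 2) ^ k) _ _).
  - intros k. change (Rabs (Cmod (Cmult (a k) (Cpow z k))) <= M * (1 / 2) ^ k).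
    rewrite Rabs_pos_eq by apply Cmod_ge_0. apply HM. lra.
  - eexists. apply is_series_half_geom.
Qed.

Lemma is_Cpseries_iff (a : nat -> C) (z l : C) :
  is_pseries (K := C_AbsRing) (V := C_NormedModule) a z l <->
  is_Cseries (fun k => Cmult (a k) (Cpow z k)) l.
Proof.
  assert (E : forall k, Cmult (pow_n (K := C_Ring) z k) (a k) = Cmult (a k) (Cpow z k)).
  { intros k. rewrite pow_n_Cpow. apply Cmult_comm. }
  split; apply is_series_ext; intros k; [exact (E k) | exact (eq_sym (E k))].
Qed.

Lemma CPSeries_unique (a : nat -> C) (z l : C) :
  is_Cseries (fun k => Cmult (a k) (Cpow z k)) l -> CPSeries a z = l.
Proof.
  intros H. apply is_Cpseries_iff in H. unfold CPSeries.
  apply (iota_unique (V := C_CompleteNormedModule)); [|exact H].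
  intros y Hy. exact (is_Cseries_unique _ _ _ Hy H).
Qed.

Lemma CPSeries_correct (a : nat -> C) (z : C) :
  rapid a -> is_Cseries (fun k => Cmult (a k) (Cpow z k)) (CPSeries a z).
Proof.
  intros Ha.
  destruct (ex_Cseries_le (fun k => Cmult (a k) (Cpow z k)) (fun k => Cmod (Cmult (a k) (Cpow z k)))) as [l Hl].
  - intros k. apply Rle_refl.
  - now apply rapid_ex_series_Cmod.
  - rewrite (CPSeries_unique _ _ _ Hl). exact Hl.
Qed.

Lemma CPSeries_bounded (a : nat -> C) (r : R) :
  rapid a -> 0 < r -> exists M : R, 0 <= M /\ forall z, Cmod z <= r -> Cmod (CPSeries a z) <= M.
Proof.
  intros Ha Hr. destruct (rapid_term_le a r Ha Hr) as [M [HM0 HM]]. exists (M * 2). split; [lra|].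
  intros z Hz.
  refine (is_Cseries_Cmod_le _ _ _ _ _ (CPSeries_correct a z Ha) (is_series_half_geom M)).
  intros k. now apply HM.
Qed.

Lemma is_Cseries_zero (u : nat -> C) : (forall n, u n = RtoC 0) -> is_Cseries u (RtoC 0).
Proof.
  intros Hu. apply (filterlim_ext (fun _ => RtoC 0)); [|apply filterlim_const].
  induction x as [|n IH]; [now rewrite sum_O, Hu|]. rewrite sum_Sn, <- IH, Hu.
  change (RtoC 0 = Cplus (RtoC 0) (RtoC 0)). ring.
Qed.

Lemma is_Cseries_head (u : nat -> C) (l : C) :
  is_Cseries (fun k => u (S k)) l -> is_Cseries u (Cplus (u O) l).
Proof.
  intros H. apply is_series_decr_1.
  refine (eq_ind l (is_Cseries (fun k => u (S k))) H _ _).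
  change (l = Cplus (Cplus (u O) l) (Copp (u O))). ring.
Qed.

Lemma CPSeries_at_0 (a : nat -> C) : CPSeries a (RtoC 0) = a O.
Proof.
  apply CPSeries_unique.
  replace (a O) with (Cplus (Cmult (a O) (Cpow (RtoC 0) 0)) (RtoC 0)) by (simpl; ring).
  apply (is_Cseries_head (fun k => Cmult (a k) (Cpow (RtoC 0) k))).
  apply is_Cseries_zero. intros n. simpl. ring.
Qed.

(** A bound at one radius serves all smaller ones. The estimates for a quotient by z - z0 are made
    at radii large compared with z0. *)
Lemma rapid_at_large (a : nat -> C) (r0 : R) :
  (forall r, r0 <= r -> 0 < r -> exists M, forall k, Cmod (a k) * r ^ k <= M) -> rapid a.
Proof.
  intros H r Hr. destruct (H (Rmax r0 r)) as [M HM]; [apply Rmax_l| |].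
  { apply Rlt_le_trans with r; [exact Hr|apply Rmax_r]. }
  exists M. intros k. eapply Rle_trans; [|apply (HM k)].
  apply Rmult_le_compat_l; [apply Cmod_ge_0|]. apply pow_incr. split; [lra|apply Rmax_r].
Qed.

(* The quotient has coefficients b_k = sum_j a_(k+1+j) z0^j, which satisfy
   b_k = a_(k+1) + z0 b_(k+1). *)
Lemma rapid_divide (a : nat -> C) (z0 : C) :
  rapid a ->
  exists b, rapid b /\ forall z, CPSeries a z = Cplus (CPSeries a z0) (Cmult (Cminus z z0) (CPSeries b z)).
Proof.
  intros Ha.
  set (v k j := Cmult (a (k + 1 + j)%nat) (Cpow z0 j)).
  (* From |a_(k+1+j)| <= M / r^(k+1+j): the surplus factor 1/r is dropped because 1 <= r, and 2|z0|
     <= r turns (|z0|/r)^j into at most (1/2)^j. *)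
  assert (Hv : forall r, 1 <= r -> 2 * Cmod z0 <= r -> exists M, 0 <= M /\ forall k j,
      Cmod (v k j) <= M * (/ r) ^ k * (1 / 2) ^ j).
  { intros r Hr1 Hr2. destruct (Ha r) as [M HM]; [lra|].
    assert (HM0 : 0 <= M) by (generalize (HM O) (Cmod_ge_0 (a O)); simpl; lra).
    exists M. split; [exact HM0|]. intros k j. unfold v. rewrite Cmod_mult, Cmod_pow.
    assert (Hp : forall n, 0 < r ^ n) by (intros n; apply pow_lt; lra).
    apply Rmult_le_reg_r with (r ^ (k + 1 + j)); [apply Hp|].
    apply Rle_trans with (M * Cmod z0 ^ j).
    { replace (Cmod (a (k + 1 + j)%nat) * Cmod z0 ^ j * r ^ (k + 1 + j))
        with (Cmod (a (k + 1 + j)%nat) * r ^ (k + 1 + j) * Cmod z0 ^ j) by ring.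
      apply Rmult_le_compat_r; [apply pow_le, Cmod_ge_0|apply HM]. }
    replace (M * (/ r) ^ k * (1 / 2) ^ j * r ^ (k + 1 + j)) with (M * (r * (r / 2) ^ j)).
    2: { replace ((r / 2) ^ j) with (r ^ j * (1 / 2) ^ j) by (rewrite <- Rpow_mult_distr; f_equal; lra).
         rewrite !pow_add, pow_1, pow_inv. generalize ((1 / 2) ^ j). intros q.
         field. apply Rgt_not_eq, Hp. }
    apply Rmult_le_compat_l; [exact HM0|].
    apply Rle_trans with (1 * (r / 2) ^ j).
    - rewrite Rmult_1_l. apply pow_incr. split; [apply Cmod_ge_0|lra].
    - apply Rmult_le_compat_r; [apply pow_le; lra|lra]. }
  set (b k := CPSeries (fun j => a (k + 1 + j)%nat) z0).
  assert (Hb : forall k, is_Cseries (v k) (b k)).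
  { intros k. destruct (Hv (Rmax 1 (2 * Cmod z0))) as [M [_ HM]]; [apply Rmax_l|apply Rmax_r|].
    destruct (ex_Cseries_le (v k) (fun j => M * (/ Rmax 1 (2 * Cmod z0)) ^ k * (1 / 2) ^ j) (HM k)) as [l Hl].
    - eexists. apply is_series_half_geom.
    - unfold b. rewrite (CPSeries_unique (fun j => a (k + 1 + j)%nat) z0 l Hl). exact Hl. }
  assert (Rb : rapid b).
  { apply (rapid_at_large b (Rmax 1 (2 * Cmod z0))). intros r Hr Hr0.
    destruct (Hv r) as [M [HM0 HM]].
    - eapply Rle_trans; [apply Rmax_l|exact Hr].
    - eapply Rle_trans; [apply Rmax_r|exact Hr].
    - exists (M * 2). intros k.
      assert (Hp : 0 < r ^ k) by now apply pow_lt.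
      apply Rle_trans with (M * (/ r) ^ k * 2 * r ^ k).
      + apply Rmult_le_compat_r; [lra|].
        exact (is_Cseries_Cmod_le _ _ _ _ (HM k) (Hb k) (is_series_half_geom _)).
      + right. rewrite pow_inv. field. lra. }
  assert (Rec : forall k, b k = Cplus (a (S k)) (Cmult z0 (b (S k)))).
  { intros k. apply (is_Cseries_unique (v k)); [apply Hb|].
    replace (a (S k)) with (v k O).
    2: { unfold v. simpl. rewrite Nat.add_0_r, Nat.add_1_r. ring. }
    apply is_Cseries_head.
    apply is_series_ext with (fun j => Cmult z0 (v (S k) j)).
    - intros j. unfold v. replace (S k + 1 + j)%nat with (k + 1 + S j)%nat by lia. simpl.
      ring.
    - exact (is_series_scal_l (K := C_AbsRing) (V := C_NormedModule) z0 _ _ (Hb (S k))). }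
  exists b. split; [exact Rb|]. intros z.
  assert (H0 : CPSeries a z0 = Cplus (a O) (Cmult z0 (b O))).
  { apply CPSeries_unique.
    replace (a O) with (Cmult (a O) (Cpow z0 0)) by (simpl; ring).
    apply (is_Cseries_head (fun k => Cmult (a k) (Cpow z0 k))).
    apply is_series_ext with (fun j => Cmult z0 (v O j)).
    - intros j. unfold v. simpl. ring.
    - exact (is_series_scal_l (K := C_AbsRing) (V := C_NormedModule) z0 _ _ (Hb O)). }
  rewrite H0. apply CPSeries_unique.
  set (B := CPSeries b z).
  assert (HB : is_Cseries (fun k => Cmult (b k) (Cpow z k)) B) by now apply CPSeries_correct.
  (* The combination z B - z0 (B - b_0) has the terms (b_k - z0 b_(k+1)) z^(k+1), which are a_(k+1)
     z^(k+1) by [Rec]. *)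
  assert (HB1 : is_Cseries (fun k => Cmult (b (S k)) (Cpow z (S k))) (Cminus B (b O))).
  { apply (is_series_incr_1 (K := C_AbsRing) (V := C_NormedModule) (fun k => Cmult (b k) (Cpow z k))).
    refine (eq_ind B (is_Cseries (fun k => Cmult (b k) (Cpow z k))) HB _ _).
    change (B = Cplus (Cminus B (b O)) (Cmult (b O) (Cpow z 0))). simpl. ring. }
  replace (Cplus (Cplus (a O) (Cmult z0 (b O))) (Cmult (Cminus z z0) B))
    with (Cplus (Cmult (a O) (Cpow z 0)) (Cplus (Cmult z B) (Copp (Cmult z0 (Cminus B (b O)))))) by (simpl; ring).
  apply (is_Cseries_head (fun k => Cmult (a k) (Cpow z k))).
  eapply is_series_ext; [|exact (is_series_minus (K := C_AbsRing) (V := C_NormedModule) _ _ _ _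
     (is_series_scal_l (K := C_AbsRing) (V := C_NormedModule) z _ _ HB)
     (is_series_scal_l (K := C_AbsRing) (V := C_NormedModule) z0 _ _ HB1))].
  intros k. cbv beta. rewrite (Rec k).
  change (Cplus (Cmult z (Cmult (Cplus (a (S k)) (Cmult z0 (b (S k)))) (Cpow z k)))
    (Copp (Cmult z0 (Cmult (b (S k)) (Cpow z (S k))))) = Cmult (a (S k)) (Cpow z (S k))).
  simpl. ring.
Qed.

(** Two divisions give f z = f z0 + (z - z0) b(z0) + (z - z0)^2 c(z) with c bounded near z0, so the
    derivative at z0 is b(z0). *)
Lemma CPSeries_entire (a : nat -> C) : rapid a -> entire (CPSeries a).
Proof.
  intros Ha z0. destruct (rapid_divide a z0 Ha) as [b [Hb Eb]].
  destruct (rapid_divide b z0 Hb) as [c [Hc Ec]].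
  destruct (CPSeries_bounded c (Cmod z0 + 1) Hc) as [M [HM0 HM]]; [generalize (Cmod_ge_0 z0); lra|].
  exists (CPSeries b z0). split; [apply is_linear_scal_l|].
  intros x Hx e.
  apply (is_filter_lim_locally_unique (K := C_AbsRing) (V := AbsRing_NormedModule C_AbsRing)) in Hx. rewrite <- Hx. clear x Hx.
  (* The 1 keeps z in the disk where c is bounded by M; the denominator is M + 1 because M may be
     0. *)
  assert (He : 0 < Rmin 1 (e / (M + 1))).
  { apply Rmin_pos; [lra|]. apply Rdiv_lt_0_compat; [apply cond_pos|lra]. }
  exists (mkposreal _ He). intros z Hz. 
  assert (Hz' : Cmod (Cminus z z0) < Rmin 1 (e / (M + 1))) by exact Hz. clear Hz.
  change (Cmod (Cminus (Cminus (CPSeries a z) (CPSeries a z0)) (Cmult (Cminus z z0) (CPSeries b z0)))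
    <= e * Cmod (Cminus z z0)).
  rewrite (Eb z), (Ec z).
  match goal with |- Cmod ?X <= _ =>
    replace X with (Cmult (Cmult (Cminus z z0) (CPSeries c z)) (Cminus z z0)) by ring end.
  rewrite !Cmod_mult. apply Rmult_le_compat_r; [apply Cmod_ge_0|].
  apply Rle_trans with (e / (M + 1) * (M + 1)); [|right; field; lra].
  apply Rmult_le_compat; try apply Cmod_ge_0.
  - left. eapply Rlt_le_trans; [exact Hz'|apply Rmin_r].
  - apply Rle_trans with M; [|lra]. apply HM.
    replace z with (Cplus z0 (Cminus z z0)) by ring.
    eapply Rle_trans; [apply Cmod_triangle|].
    generalize (Rmin_l 1 (e / (M + 1))). lra.
Qed.

(** * Products and the exponential series *)

Lemma Csum_n_Cmult_r (u : nat -> C) (c : C) (n : nat) :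
  Csum_n (fun k => Cmult (u k) c) n = Cmult (Csum_n u n) c.
Proof. exact (sum_n_mult_r (K := C_Ring) c u n). Qed.

Lemma Csum_n_Cmult_l (u : nat -> C) (c : C) (n : nat) :
  Csum_n (fun k => Cmult c (u k)) n = Cmult c (Csum_n u n).
Proof. exact (sum_n_mult_l (K := C_Ring) c u n). Qed.

Lemma Csum_n_plus (u v : nat -> C) (n : nat) :
  Csum_n (fun k => Cplus (u k) (v k)) n = Cplus (Csum_n u n) (Csum_n v n).
Proof. exact (sum_n_plus (G := C_AbelianMonoid) u v n). Qed.

Lemma Csum_n_first (u : nat -> C) (n : nat) :
  Csum_n u (S n) = Cplus (u O) (Csum_n (fun k => u (S k)) n).
Proof.
  induction n as [|n IH]; [rewrite Csum_n_Sn, !Csum_n_O; reflexivity|].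
  rewrite Csum_n_Sn, IH, (Csum_n_Sn (fun k => u (S k))). ring.
Qed.

Lemma Csum_n_ext_loc (u v : nat -> C) (n : nat) :
  (forall k, (k <= n)%nat -> u k = v k) -> Csum_n u n = Csum_n v n.
Proof. exact (sum_n_ext_loc (G := C_AbelianMonoid) u v n). Qed.

Lemma Cmod_Csum_n_le (u : nat -> C) (M : R) (n : nat) :
  (forall k, (k <= n)%nat -> Cmod (u k) <= M) -> Cmod (Csum_n u n) <= INR (S n) * M.
Proof.
  induction n as [|n IH]; intros H.
  - rewrite Csum_n_O. simpl. rewrite Rmult_1_l. apply H. lia.
  - rewrite Csum_n_Sn. eapply Rle_trans; [apply Cmod_triangle|].
    rewrite (S_INR (S n)), Rmult_plus_distr_r, Rmult_1_l.
    apply Rplus_le_compat; [apply IH; intros k Hk|]; apply H; lia.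
Qed.

Definition Cconv (a b : nat -> C) (n : nat) : C :=
  Csum_n (fun k => Cmult (a k) (b (n - k)%nat)) n.

Lemma Cconv_Cpow (a b : nat -> C) (z : C) (n : nat) :
  Cmult (Cconv a b n) (Cpow z n) =
  Cconv (fun k => Cmult (a k) (Cpow z k)) (fun k => Cmult (b k) (Cpow z k)) n.
Proof.
  unfold Cconv. rewrite <- Csum_n_Cmult_r. apply Csum_n_ext_loc. intros k Hk.
  replace n with (k + (n - k))%nat at 2 by lia. rewrite Cpow_add_r. ring.
Qed.

(** At radius r each of the n + 1 summands is at most Ma Mb (1/2)^n, and (n + 1) (1/2)^n <= 1. *)
Lemma rapid_conv (a b : nat -> C) : rapid a -> rapid b -> rapid (Cconv a b).
Proof.
  intros Ha Hb r Hr.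
  destruct (rapid_term_le a r Ha Hr) as [Ma [Ma0 HMa]].
  destruct (rapid_term_le b r Hb Hr) as [Mb [Mb0 HMb]].
  exists (Ma * Mb). intros n.
  assert (Er : Cmod (RtoC r) = r) by (rewrite Cmod_R; apply Rabs_pos_eq; lra).
  replace (Cmod (Cconv a b n) * r ^ n) with (Cmod (Cmult (Cconv a b n) (Cpow (RtoC r) n)))
    by (rewrite Cmod_mult, Cmod_pow, Er; reflexivity).
  rewrite Cconv_Cpow.
  apply Rle_trans with (INR (S n) * (Ma * Mb * (1 / 2) ^ n)).
  - apply Cmod_Csum_n_le. intros k Hk. rewrite Cmod_mult.
    replace (Ma * Mb * (1 / 2) ^ n) with (Ma * (1 / 2) ^ k * (Mb * (1 / 2) ^ (n - k))).
    + apply Rmult_le_compat; try apply Cmod_ge_0; [apply HMa|apply HMb]; lra.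
    + replace n with (k + (n - k))%nat at 2 by lia. rewrite pow_add. ring.
  - assert (E : INR (S n) * (1 / 2) ^ n <= 1).
    { clear. induction n as [|n IH]; [simpl; lra|].
      rewrite !S_INR in *. simpl pow. assert (Hn := pos_INR n).
      assert (Hp := pow_le (1 / 2) n ltac:(lra)). assert (H := Rmult_le_pos _ _ Hn Hp).
      generalize dependent ((1 / 2) ^ n). intros p. lra. }
    replace (INR (S n) * (Ma * Mb * (1 / 2) ^ n)) with (Ma * Mb * (INR (S n) * (1 / 2) ^ n)) by ring.
    rewrite <- (Rmult_1_r (Ma * Mb)) at 2.
    apply Rmult_le_compat_l; [now apply Rmult_le_pos|exact E].
Qed.

Lemma CPSeries_mult (a b : nat -> C) (z : C) :
  rapid a -> rapid b -> CPSeries (Cconv a b) z = Cmult (CPSeries a z) (CPSeries b z).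
Proof.
  intros Ha Hb. apply CPSeries_unique.
  eapply is_series_ext; [intros n; symmetry; apply Cconv_Cpow|].
  apply is_Cseries_mult; [now apply CPSeries_correct|now apply CPSeries_correct| |];
    now apply rapid_ex_series_Cmod.
Qed.

Definition exp_coef (n : nat) : C := RtoC (/ INR (fact n)).

Lemma series_term_le (u : nat -> R) (l : R) (k : nat) :
  (forall n, 0 <= u n) -> is_series u l -> u k <= l.
Proof.
  intros Hu H. apply is_series_Reals in H.
  apply Rle_trans with (sum_f_R0 u k); [|now apply sum_incr].
  destruct k as [|k]; simpl; [lra|]. generalize (cond_pos_sum u k Hu). lra.
Qed.

Lemma rapid_exp_coef : rapid exp_coef.
Proof.
  intros r Hr. exists (exp r). intros k. unfold exp_coef.
  rewrite Cmod_R, Rabs_pos_eq by (left; apply Rinv_0_lt_compat, INR_fact_lt_0).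
  apply (series_term_le (fun n => / INR (fact n) * r ^ n)); [|apply is_pseries_R, is_exp_Reals].
  intros n. apply Rmult_le_pos; [left; apply Rinv_0_lt_compat, INR_fact_lt_0|apply pow_le; lra].
Qed.

(* With E_n the left-hand side, (n + 1) E_(n+1) = (x + y) E_n. *)
Lemma Cconv_exp_binomial (x y : C) (n : nat) :
  Cconv (fun k => Cmult (exp_coef k) (Cpow x k)) (fun k => Cmult (exp_coef k) (Cpow y k)) n =
  Cmult (exp_coef n) (Cpow (Cplus x y) n).
Proof.
  assert (Efact : forall k, exp_coef k = Cmult (RtoC (INR (S k))) (exp_coef (S k))).
  { intros k. unfold exp_coef. rewrite <- RtoC_mult. f_equal.
    rewrite fact_simpl, mult_INR. field. split; [apply INR_fact_neq_0|apply not_0_INR; lia]. }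
  assert (Eterm : forall w k, Cmult (RtoC (INR (S k))) (Cmult (exp_coef (S k)) (Cpow w (S k))) =
     Cmult w (Cmult (exp_coef k) (Cpow w k))).
  { intros w k. rewrite (Efact k). simpl. ring. }
  unfold Cconv. induction n as [|n IH].
  { rewrite Csum_n_O. unfold exp_coef. simpl. rewrite Rinv_1. ring. }
  assert (Hn : RtoC (INR (S n)) <> RtoC 0).
  { intros H. apply RtoC_inj in H. revert H. apply not_0_INR. lia. }
  match goal with |- ?L = ?Rr =>
    assert (E : Cmult (RtoC (INR (S n))) L = Cmult (RtoC (INR (S n))) Rr) end.
  2: { apply (f_equal (Cmult (Cinv (RtoC (INR (S n)))))) in E.
       rewrite !Cmult_assoc, Cinv_l, !Cmult_1_l in E by exact Hn.
       exact E. }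
  transitivity (Cmult (Cplus x y) (Cmult (exp_coef n) (Cpow (Cplus x y) n))).
  2: { rewrite (Efact n). simpl. ring. }
  rewrite <- IH, Cmult_plus_distr_r.
  rewrite <- Csum_n_Cmult_l.
  (* The splitting n + 1 = k + (n + 1 - k) acts as a product rule: the first part lowers the power
     of x, the second that of y, and each part loses one end term. *)
  rewrite (Csum_n_ext_loc _ (fun k => Cplus
     (Cmult (Cmult (RtoC (INR k)) (Cmult (exp_coef k) (Cpow x k))) (Cmult (exp_coef (S n - k)) (Cpow y (S n - k))))
     (Cmult (Cmult (exp_coef k) (Cpow x k)) (Cmult (RtoC (INR (S n - k))) (Cmult (exp_coef (S n - k)) (Cpow y (S n - k))))))).
  2: { intros k Hk. replace (RtoC (INR (S n))) with (Cplus (RtoC (INR k)) (RtoC (INR (S n - k)))).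
       - ring.
       - rewrite <- RtoC_plus, <- plus_INR. do 3 f_equal. lia. }
  rewrite Csum_n_plus. f_equal.
  - rewrite Csum_n_first, <- Csum_n_Cmult_l. simpl (INR 0).
    transitivity (Cplus (RtoC 0) (Csum_n (fun k => Cmult x (Cmult (Cmult (exp_coef k) (Cpow x k))
      (Cmult (exp_coef (n - k)) (Cpow y (n - k))))) n)); [|ring].
    f_equal; [ring|]. apply Csum_n_ext_loc. intros k Hk. rewrite Eterm. simpl (S n - S k)%nat. ring.
  - rewrite Csum_n_Sn, <- Csum_n_Cmult_l. rewrite Nat.sub_diag. simpl (INR 0).
    transitivity (Cplus (Csum_n (fun k => Cmult y (Cmult (Cmult (exp_coef k) (Cpow x k))
      (Cmult (exp_coef (n - k)) (Cpow y (n - k))))) n) (RtoC 0)); [|ring].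
    f_equal; [|ring]. apply Csum_n_ext_loc. intros k Hk.
    replace (S n - k)%nat with (S (n - k)) by lia. rewrite Eterm. ring.
Qed.

Lemma is_series_cos (y : R) : is_series (fun n => cos_n n * (y * y) ^ n) (cos y).
Proof.
  apply is_series_Reals. unfold cos. destruct (exist_cos (Rsqr y)) as [l Hl]. exact Hl.
Qed.

Lemma is_series_sin (y : R) : is_series (fun n => y * (sin_n n * (y * y) ^ n)) (sin y).
Proof.
  unfold sin. destruct (exist_sin (Rsqr y)) as [l Hl].
  apply (is_series_scal_l (K := R_AbsRing) (V := R_NormedModule) y (fun n => sin_n n * (y * y) ^ n)).
  apply is_series_Reals. exact Hl.
Qed.

Lemma Cpow_imag_even (y : R) (n : nat) : Cpow (0, y) (2 * n) = RtoC ((-1) ^ n * (y * y) ^ n).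
Proof.
  rewrite Cpow_mult_r. replace (Cpow (0, y) 2) with (RtoC (- (y * y))).
  - rewrite <- RtoC_pow. f_equal. rewrite <- Rpow_mult_distr. f_equal. ring.
  - simpl. unfold RtoC, Cmult. simpl. f_equal; ring.
Qed.

Lemma Cpow_imag_odd (y : R) (n : nat) : Cpow (0, y) (2 * n + 1) = (0, y * ((-1) ^ n * (y * y) ^ n)).
Proof.
  rewrite Cpow_add_r, Cpow_imag_even, Cpow_1_r. unfold RtoC, Cmult. simpl. f_equal; ring.
Qed.

Lemma is_Rseries_ext (u v : nat -> R) (l : R) : (forall n, u n = v n) -> is_series u l -> is_series v l.
Proof. apply is_series_ext. Qed.

Lemma is_Rseries_zero (u : nat -> R) : (forall n, u n = 0) -> is_series u 0.
Proof.
  intros Hu. apply (is_Rseries_ext (fun k => 0 * (1 / 2) ^ k)).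
  - intros n. rewrite Hu. ring.
  - assert (H := is_series_half_geom 0). rewrite Rmult_0_l in H. exact H.
Qed.

(** The splitting of a power series into its even and odd parts, taken at the point 1. *)
Lemma is_series_even_odd (u : nat -> R) (l1 l2 : R) :
  is_series (fun n => u (2 * n)%nat) l1 -> is_series (fun n => u (2 * n + 1)%nat) l2 ->
  is_series u (l1 + l2).
Proof.
  intros H1 H2. replace (l1 + l2) with (l1 + 1 * l2) by ring.
  assert (E : forall (v : nat -> R) (l : R), is_series v l -> is_pseries v (1 ^ 2) l).
  { intros v l H. rewrite pow1. apply is_pseries_R. revert H. apply is_Rseries_ext.
    intros n. rewrite pow1. ring. }
  assert (H := is_pseries_odd_even u 1 l1 l2 (E _ _ H1) (E _ _ H2)).
  apply is_pseries_R in H. revert H. apply is_Rseries_ext. intros n. rewrite pow1. ring.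
Qed.

Lemma is_Cseries_exp_imag (y : R) :
  is_Cseries (fun k => Cmult (exp_coef k) (Cpow (0, y) k)) (cos y, sin y).
Proof.
  apply is_Cseries_components. split.
  - replace (Re (cos y, sin y)) with (cos y + 0) by (simpl; ring).
    apply is_series_even_odd.
    + eapply is_Rseries_ext; [|exact (is_series_cos y)].
      intros n. unfold exp_coef. rewrite re_scal_l, Cpow_imag_even, re_RtoC. unfold cos_n. field.
      apply INR_fact_neq_0.
    + apply is_Rseries_zero. intros n. unfold exp_coef. rewrite re_scal_l, Cpow_imag_odd. simpl.
      ring.
  - replace (Im (cos y, sin y)) with (0 + sin y) by (simpl; ring).
    apply is_series_even_odd.
    + apply is_Rseries_zero. intros n. unfold exp_coef. rewrite im_scal_l, Cpow_imag_even. simpl.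
      ring.
    + eapply is_Rseries_ext; [|exact (is_series_sin y)].
      intros n. unfold exp_coef. rewrite im_scal_l, Cpow_imag_odd. unfold sin_n.
      change (Im (0, y * ((-1) ^ n * (y * y) ^ n))) with (y * ((-1) ^ n * (y * y) ^ n)). field.
      apply INR_fact_neq_0.
Qed.

Lemma is_Cseries_exp_real (x : R) :
  is_Cseries (fun k => Cmult (exp_coef k) (Cpow (RtoC x) k)) (RtoC (exp x)).
Proof.
  apply is_Cseries_components. unfold exp_coef. split.
  - apply (is_Rseries_ext (fun n => / INR (fact n) * x ^ n)); [|apply is_pseries_R, is_exp_Reals].
    intros n. rewrite <- RtoC_pow, <- RtoC_mult, re_RtoC. reflexivity.
  - apply is_Rseries_zero. intros n. rewrite <- RtoC_pow, <- RtoC_mult. reflexivity.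
Qed.

(** The Cauchy product of the exponential series at Re z and at i Im z collapses to the series at z
    by the binomial theorem. *)
Lemma Cexp_CPSeries (z : C) : Cexp z = CPSeries exp_coef z.
Proof.
  symmetry. apply CPSeries_unique.
  assert (H := is_Cseries_mult _ _ _ _ (is_Cseries_exp_real (Re z)) (is_Cseries_exp_imag (Im z))
     (rapid_ex_series_Cmod _ _ rapid_exp_coef) (rapid_ex_series_Cmod _ _ rapid_exp_coef)).
  replace (Cexp z) with (Cmult (RtoC (exp (Re z))) (cos (Im z), sin (Im z))).
  2: { unfold Cexp, Cmult, RtoC. simpl. f_equal; ring. }
  revert H. apply is_series_ext. intros n.
  transitivity (Cmult (exp_coef n) (Cpow (Cplus (RtoC (Re z)) (0, Im z)) n));
    [apply Cconv_exp_binomial|].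
  do 2 f_equal. destruct z as [x y]. unfold Cplus, RtoC. simpl. f_equal; ring.
Qed.

Lemma Cmod_Cexp (z : C) : Cmod (Cexp z) = exp (Re z).
Proof.
  replace (Cexp z) with (Cmult (RtoC (exp (Re z))) (cos (Im z), sin (Im z))).
  2: { unfold Cexp, Cmult, RtoC. simpl. f_equal; ring. }
  rewrite Cmod_mult, Cmod_R, Rabs_pos_eq by (left; apply exp_pos).
  unfold Cmod. simpl.
  replace (cos (Im z) * (cos (Im z) * 1) + sin (Im z) * (sin (Im z) * 1)) with 1.
  - rewrite sqrt_1. ring.
  - generalize (sin2_cos2 (Im z)). unfold Rsqr. lra.
Qed.

(** The working notion of an entire function: products and division by a linear factor act on the
    coefficients, and [entire] follows from it. *)
Definition entire_series (f : C -> C) : Prop :=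
  exists a, rapid a /\ forall z, f z = CPSeries a z.

Lemma entire_series_entire (f : C -> C) : entire_series f -> entire f.
Proof.
  intros [a [Ha E]] z. apply (ex_derive_ext (CPSeries a)); [intros t; symmetry; apply E|].
  now apply CPSeries_entire.
Qed.

Lemma entire_series_mult (f g : C -> C) :
  entire_series f -> entire_series g -> entire_series (fun z => Cmult (f z) (g z)).
Proof.
  intros [a [Ha Ea]] [b [Hb Eb]]. exists (Cconv a b). split; [now apply rapid_conv|].
  intros z. rewrite CPSeries_mult, Ea, Eb by assumption. reflexivity.
Qed.

Lemma entire_series_Cexp : entire_series Cexp.
Proof. exists exp_coef. split; [apply rapid_exp_coef|apply Cexp_CPSeries]. Qed.

Lemma entire_series_affine (c d : C) : entire_series (fun z => Cplus c (Cmult d z)).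
Proof.
  exists (fun k => match k with O => c | 1%nat => d | _ => RtoC 0 end). split.
  - intros r Hr. exists (Cmod c + Cmod d * r). assert (Hc := Cmod_ge_0 c).
    assert (Hd := Rmult_le_pos _ _ (Cmod_ge_0 d) (Rlt_le _ _ Hr)).
    intros [|[|k]]; simpl; [lra|lra|]. rewrite Cmod_0, Rmult_0_l. lra.
  - intros z. symmetry. apply CPSeries_unique.
    replace (Cplus c (Cmult d z)) with (Cplus (Cmult c (Cpow z 0)) (Cplus (Cmult d (Cpow z 1)) (RtoC 0))) by (simpl; ring).
    do 2 (match goal with |- is_Cseries ?u _ => apply (is_Cseries_head u) end).
    apply is_Cseries_zero. intros n. ring.
Qed.

Lemma entire_series_divide (f : C -> C) (z0 : C) :
  entire_series f -> f z0 = RtoC 0 ->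
  exists g, entire_series g /\ forall z, f z = Cmult (Cminus z z0) (g z).
Proof.
  intros [a [Ha E]] H0. destruct (rapid_divide a z0 Ha) as [b [Hb Eb]].
  exists (CPSeries b). split; [now exists b|].
  intros z. rewrite E, Eb, <- (E z0), H0. ring.
Qed.

(** * Counting zeros *)

Definition cis (t : R) : C := (cos t, sin t).

Lemma Cmod_cis (t : R) : Cmod (cis t) = 1.
Proof.
  replace (cis t) with (Cexp (0, t)).
  - rewrite Cmod_Cexp. apply exp_0.
  - unfold Cexp, cis. simpl. rewrite exp_0. f_equal; ring.
Qed.

Lemma Cpow_cis (t : R) (n : nat) : Cpow (cis t) n = cis (INR n * t).
Proof.
  induction n as [|n IH].
  - simpl. unfold cis. rewrite Rmult_0_l, cos_0, sin_0. reflexivity.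
  - rewrite Cpow_S, IH, S_INR, Rmult_plus_distr_r, Rmult_1_l. unfold cis.
    rewrite cos_plus, sin_plus. unfold Cmult. simpl. f_equal; ring.
Qed.

Lemma cis_neq_1 (t : R) : 0 < t < 2 * PI -> cis t <> RtoC 1.
Proof.
  intros Ht H. injection H as H _.
  assert (Hs : 0 < sin (t / 2)) by (apply sin_gt_0; lra).
  replace t with (2 * (t / 2)) in H by lra. rewrite cos_2a_sin in H. nra.
Qed.

Lemma Csum_n_geom (w : C) (n : nat) :
  Cmult (Cminus w (RtoC 1)) (Csum_n (Cpow w) n) = Cminus (Cpow w (S n)) (RtoC 1).
Proof.
  induction n as [|n IH]; [rewrite Csum_n_O; simpl; ring|].
  rewrite Csum_n_Sn, Cmult_plus_distr_l, IH. simpl. ring.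
Qed.

(** A geometric sum whose ratio w satisfies w^(n+1) = 1, while 0 < k <= n ensures w <> 1. *)
Lemma Csum_n_roots_of_unity (n k : nat) :
  (0 < k <= n)%nat -> Csum_n (fun j => Cpow (cis (INR k * (2 * PI / INR (S n)))) j) n = RtoC 0.
Proof.
  intros Hk. set (w := cis (INR k * (2 * PI / INR (S n)))).
  assert (HS : 0 < INR (S n)) by (apply lt_0_INR; lia).
  assert (Hk0 : 0 < INR k) by (apply lt_0_INR; lia).
  assert (Hkn : INR k < INR (S n)) by (apply lt_INR; lia).
  assert (HPI := PI_RGT_0).
  assert (Hw : Cminus w (RtoC 1) <> RtoC 0).
  { intros H. apply (cis_neq_1 (INR k * (2 * PI / INR (S n)))).
    - split; [apply Rmult_lt_0_compat; [exact Hk0|]; apply Rdiv_lt_0_compat; lra|].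
      replace (INR k * (2 * PI / INR (S n))) with (2 * PI * INR k / INR (S n)) by (field; lra).
      apply Rlt_div_l; [lra|]. apply Rmult_lt_compat_l; lra.
    - fold w. replace w with (Cplus (Cminus w (RtoC 1)) (RtoC 1)) by ring. rewrite H. ring. }
  assert (H1 : Cpow w (S n) = RtoC 1).
  { unfold w. rewrite Cpow_cis.
    replace (INR (S n) * (INR k * (2 * PI / INR (S n)))) with (0 + 2 * INR k * PI) by (field; lra).
    unfold cis. rewrite cos_period, sin_period, cos_0, sin_0. reflexivity. }
  assert (E := Csum_n_geom w n). rewrite H1 in E.
  apply (f_equal (Cmult (Cinv (Cminus w (RtoC 1))))) in E.
  rewrite Cmult_assoc, Cinv_l, Cmult_1_l in E by exact Hw. change (Csum_n (Cpow w) n = RtoC 0).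
  rewrite E. ring.
Qed.

Lemma is_Cseries_Csum_n (u : nat -> nat -> C) (s : nat -> C) (n : nat) :
  (forall j, is_Cseries (u j) (s j)) -> is_Cseries (fun k => Csum_n (fun j => u j k) n) (Csum_n s n).
Proof.
  intros H. induction n as [|n IH].
  - rewrite Csum_n_O. eapply is_series_ext; [|apply H]. intros k. symmetry.
    exact (Csum_n_O (fun j => u j k)).
  - rewrite Csum_n_Sn. eapply is_series_ext; [|exact (is_series_plus _ _ _ _ IH (H (S n)))].
    intros k. symmetry. exact (Csum_n_Sn (fun j => u j k) n).
Qed.

(* Averaging over the N-th roots of unity kills the coefficients of index
   1, ..., N - 1. *)
Lemma entire_series_max_modulus_center (f : C -> C) (r M : R) :
  entire_series f -> 0 < r -> (forall z, Cmod z = r -> Cmod (f z) <= M) -> Cmod (f (RtoC 0)) <= M.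
Proof.
  intros [a [Ha E]] Hr HM. rewrite E, CPSeries_at_0.
  destruct (rapid_term_le a (2 * r) Ha) as [M0 [HM0 Hterm]]; [lra|].
  (* The majorant taken at radius 2r decays like (1/4)^k at radius r: one factor (1/2)^k sums the
     tail, the other makes it small as n grows. *)
  assert (Hcoef : forall k, Cmod (a k) * r ^ k <= M0 * (1 / 2) ^ k * (1 / 2) ^ k).
  { intros k. assert (H := Hterm k (RtoC (2 * r))).
    rewrite Cmod_mult, Cmod_pow, Cmod_R, Rabs_pos_eq in H by lra.
    replace (Cmod (a k) * r ^ k) with (Cmod (a k) * (2 * r) ^ k * (1 / 2) ^ k).
    - apply Rmult_le_compat_r; [apply pow_le; lra|]. apply H. lra.
    - rewrite Rmult_assoc, <- Rpow_mult_distr. do 2 f_equal. lra. }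
  assert (Avg : forall n, Cmod (a O) <= M + 2 * M0 * (1 / 2) ^ n).
  { intros n. set (t := 2 * PI / INR (S n)).
    assert (HS : 0 < INR (S n)) by (apply lt_0_INR; lia).
    set (p j := Cmult (RtoC r) (Cpow (cis t) j)).
    assert (Hp : forall j, Cmod (p j) = r).
    { intros j. unfold p. rewrite Cmod_mult, Cmod_pow, Cmod_cis, pow1, Cmod_R, Rabs_pos_eq; lra. }
    set (u k := Csum_n (fun j => Cmult (a k) (Cpow (p j) k)) n).
    assert (Hu : is_Cseries u (Csum_n (fun j => f (p j)) n)).
    { apply (is_Cseries_Csum_n (fun j k => Cmult (a k) (Cpow (p j) k)) (fun j => f (p j))).
      intros j. rewrite E. now apply CPSeries_correct. }
    assert (Hu0 : u O = Cmult (RtoC (INR (S n))) (a O)).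
    { unfold u. generalize n. intros m. induction m as [|m IH].
      - rewrite Csum_n_O. simpl. ring.
      - rewrite Csum_n_Sn, IH, (S_INR (S m)), RtoC_plus. simpl Cpow. ring. }
    assert (Huk : forall k, Cmod (u (S k)) <= INR (S n) * M0 * (1 / 2) ^ n * (1 / 2) ^ k).
    { intros k. destruct (Nat.le_gt_cases (S k) n) as [Hk|Hk].
      - replace (u (S k)) with (RtoC 0).
        + rewrite Cmod_0. repeat apply Rmult_le_pos; try apply pow_le; lra.
        + symmetry. unfold u. rewrite Csum_n_Cmult_l.
          rewrite (Csum_n_ext_loc _ (fun j => Cmult (Cpow (RtoC r) (S k)) (Cpow (cis (INR (S k) * t)) j))).
          2: { intros j _. unfold p. rewrite Cpow_mult_l, <- Cpow_cis, <- !Cpow_mult_r.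
               do 2 f_equal. lia. }
          rewrite Csum_n_Cmult_l. unfold t. rewrite Csum_n_roots_of_unity by lia. ring.
      - eapply Rle_trans; [apply (Cmod_Csum_n_le _ (M0 * (1 / 2) ^ n * (1 / 2) ^ k))|right; ring].
        intros j _. rewrite Cmod_mult, Cmod_pow, Hp. eapply Rle_trans; [apply Hcoef|].
        assert (Hdec : forall i m, (i <= m)%nat -> (1 / 2) ^ m <= (1 / 2) ^ i).
        { intros i m Him. replace m with (i + (m - i))%nat by lia. rewrite pow_add.
          rewrite <- (Rmult_1_r ((1 / 2) ^ i)) at 2. apply Rmult_le_compat_l; [apply pow_le; lra|].
          apply Rle_trans with (1 ^ (m - i)); [apply pow_incr; lra|rewrite pow1; lra]. }
        apply Rmult_le_compat; try (apply Rmult_le_pos;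
          [lra|apply pow_le; lra]); try (apply pow_le; lra).
        + apply Rmult_le_compat_l; [exact HM0|]. apply Hdec. lia.
        + apply Hdec. lia. }
    assert (Htail : is_Cseries (fun k => u (S k)) (Cminus (Csum_n (fun j => f (p j)) n) (u O))).
    { apply (is_series_incr_1 (K := C_AbsRing) (V := C_NormedModule) u).
      refine (eq_ind _ (is_Cseries u) Hu _ _).
      match goal with |- ?x = _ => change (x = Cplus (Cminus x (u O)) (u O)) end. ring. }
    assert (Hle := is_Cseries_Cmod_le _ _ _ _ Huk Htail (is_series_half_geom _)).
    assert (Hsum : Cmod (Csum_n (fun j => f (p j)) n) <= INR (S n) * M).
    { apply Cmod_Csum_n_le. intros j _. apply HM, Hp. }
    assert (Hmain : INR (S n) * Cmod (a O) <= INR (S n) * (M + 2 * M0 * (1 / 2) ^ n)).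
    { replace (INR (S n) * Cmod (a O)) with (Cmod (u O)).
      2: { rewrite Hu0, Cmod_mult, Cmod_R, Rabs_pos_eq; lra. }
      set (s := Csum_n (fun j => f (p j)) n) in *.
      replace (u O) with (Cplus s (Copp (Cminus s (u O)))) by ring.
      eapply Rle_trans; [apply Cmod_triangle|]. rewrite Cmod_opp. lra. }
    now apply Rmult_le_reg_l in Hmain. }
  destruct (Rle_or_lt (Cmod (a O)) M) as [H|H]; [exact H|exfalso].
  destruct (pow_lt_1_zero (1 / 2)) with (y := (Cmod (a O) - M) / (2 * M0 + 1)) as [n Hn].
  - rewrite Rabs_pos_eq; lra.
  - apply Rdiv_lt_0_compat; lra.
  - specialize (Hn n (Nat.le_refl n)). specialize (Avg n).
    rewrite Rabs_pos_eq in Hn by (apply pow_le; lra).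
    apply Rlt_div_r in Hn; [|lra]. assert (Hq : 0 < (1 / 2) ^ n) by (apply pow_lt; lra). lra.
Qed.

(** * Factoring out zeros *)

Definition root_product (l : list C) (z : C) : C :=
  fold_right (fun a p => Cmult (Cminus z a) p) (RtoC 1) l.

Lemma entire_series_ext (f g : C -> C) : (forall z, f z = g z) -> entire_series f -> entire_series g.
Proof. intros H [a [Ha E]]. exists a. split; [exact Ha|]. intros z. rewrite <- H. apply E. Qed.

Lemma entire_series_root_product (l : list C) : entire_series (root_product l).
Proof.
  induction l as [|a l IH].
  - apply (entire_series_ext (fun z => Cplus (RtoC 1) (Cmult (RtoC 0) z)));
      [|apply entire_series_affine].
    intros z. simpl. ring.
  - apply (entire_series_ext (fun z => Cmult (Cplus (Copp a) (Cmult (RtoC 1) z)) (root_product l z))).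
    + intros z. simpl. ring.
    + apply entire_series_mult; [apply entire_series_affine|exact IH].
Qed.

Lemma root_product_neq_0 (l : list C) (z : C) : ~ In z l -> root_product l z <> RtoC 0.
Proof.
  induction l as [|a l IH]; simpl; intros H.
  - intros E. apply RtoC_inj in E. lra.
  - apply Cmult_neq_0; [|tauto]. intros E. apply H. left.
    replace z with (Cplus (Cminus z a) a) by ring. rewrite E. ring.
Qed.

(** Collecting the factors equal to z - a leaves a product that does not vanish at a, which is the
    shape that [vanishing_order] asks for. *)
Lemma root_product_count (l : list C) (a z : C) :
  root_product l z =
  Cmult (Cpow (Cminus z a) (count_occ Ceq_dec l a)) (root_product (remove Ceq_dec a l) z).
Proof.
  induction l as [|b l IH]; [simpl; ring|]. simpl.
  destruct (Ceq_dec b a) as [Hba|Hba], (Ceq_dec a b) as [Hab|Hab]; try congruence; simpl; rewrite IH;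
    [rewrite Hba|]; ring.
Qed.

Lemma zero_count_of_factorization (f g : C -> C) (l : list C) (r : R) :
  entire_series g -> (forall z, f z = Cmult (root_product l z) (g z)) ->
  (forall a, In a l -> Cmod a <= r) -> (forall z, Cmod z <= r -> g z <> RtoC 0) ->
  zero_count f r (length l).
Proof.
  intros Hg Hf Hl Hz. exists l. split; [reflexivity|]. intros z. split.
  - intros Hzr. exists (fun w => Cmult (root_product (remove Ceq_dec z l) w) (g w)). repeat split.
    + apply entire_series_entire, entire_series_mult; [apply entire_series_root_product|exact Hg].
    + apply Cmult_neq_0; [apply root_product_neq_0, remove_In|now apply Hz].
    + intros w. rewrite Hf, (root_product_count l z w). ring.
  - intros Hzr Hin. apply Hl in Hin. lra.
Qed.

Lemma Cmod_root_product_le (l : list C) (r : R) :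
  (forall a, In a l -> Cmod a <= r) -> Cmod (root_product l (RtoC 0)) <= r ^ length l.
Proof.
  induction l as [|a l IH]; simpl; intros H; [rewrite Cmod_1; lra|].
  rewrite Cmod_mult. apply Rmult_le_compat; try apply Cmod_ge_0; [|now apply IH; auto].
  replace (Cminus (RtoC 0) a) with (Copp a) by ring. rewrite Cmod_opp. auto.
Qed.

Lemma Cmod_root_product_ge (l : list C) (r : R) (z : C) :
  0 < r -> Cmod z = 4 * r -> (forall a, In a l -> Cmod a <= r) ->
  (3 * r) ^ length l <= Cmod (root_product l z).
Proof.
  intros Hr Hz. induction l as [|a l IH]; simpl; intros H; [rewrite Cmod_1; lra|].
  rewrite Cmod_mult. apply Rmult_le_compat; [lra|apply pow_le; lra| |now apply IH; auto].
  assert (Ha : Cmod a <= r) by auto.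
  assert (Ht := Cmod_triangle (Cminus z a) a).
  replace (Cplus (Cminus z a) a) with z in Ht by ring. lra.
Qed.

(** On the circle of radius 4r every factor z - a has modulus at least 3r, at the origin at most r;
    each zero thus contributes a factor 3 when g at 0 is compared with g on the circle. *)
Lemma root_count_le (f g : C -> C) (l : list C) (r M : R) :
  entire_series g -> (forall z, f z = Cmult (root_product l z) (g z)) ->
  0 < r -> (forall a, In a l -> Cmod a <= r) -> (forall z, Cmod z = 4 * r -> Cmod (f z) <= M) ->
  Cmod (f (RtoC 0)) * 3 ^ length l <= M.
Proof.
  intros Hg Hf Hr Hl HM.
  assert (Hp : 0 < (3 * r) ^ length l) by (apply pow_lt; lra).
  assert (H0 : Cmod (g (RtoC 0)) <= M / (3 * r) ^ length l).
  { apply (entire_series_max_modulus_center g (4 * r)); [exact Hg|lra|].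
    intros z Hz. apply Rle_div_r; [lra|]. apply Rle_trans with (Cmod (f z)); [|now apply HM].
    rewrite Hf, Cmod_mult, Rmult_comm. apply Rmult_le_compat_r; [apply Cmod_ge_0|].
    now apply Cmod_root_product_ge. }
  apply Rle_div_r in H0; [|lra].
  apply Rle_trans with (2 := H0). rewrite Hf, Cmod_mult, Rpow_mult_distr.
  replace (Cmod (g (RtoC 0)) * (3 ^ length l * r ^ length l)) with (r ^ length l * Cmod (g (RtoC 0)) * 3 ^ length l) by ring.
  apply Rmult_le_compat_r; [apply pow_le; lra|]. apply Rmult_le_compat_r; [apply Cmod_ge_0|].
  now apply Cmod_root_product_le.
Qed.

Lemma le_pow_3 (n : nat) : INR n <= 3 ^ n.
Proof. induction n as [|n IH]; [simpl; lra|]. rewrite S_INR. simpl pow.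
assert (1 <= 3 ^ n) by (apply pow_R1_Rle; lra). lra. Qed.

(* Zeros are split off one at a time; [root_count_le] forces the process to
   stop. *)
Lemma entire_series_split_zeros (f : C -> C) (r : R) :
  entire_series f -> f (RtoC 0) <> RtoC 0 ->
  exists l g, entire_series g /\ (forall z, f z = Cmult (root_product l z) (g z)) /\
    (forall a, In a l -> Cmod a <= r) /\ (forall z, Cmod z <= r -> g z <> RtoC 0).
Proof.
  intros Hf H0.
  set (split_off l g := entire_series g /\ (forall z, f z = Cmult (root_product l z) (g z)) /\
     (forall a, In a l -> Cmod a <= r)).
  apply NNPP. intros Hno.
  assert (All : forall n, exists l g, split_off l g /\ length l = n).
  { induction n as [|n [l [g [[Hg [Hfg Hl]] Hn]]]].
    - exists nil, f. repeat split; [exact Hf| |intros a []]. intros z. simpl. ring.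
    - assert (Hz : exists a, Cmod a <= r /\ g a = RtoC 0).
      { apply NNPP. intros H. apply Hno. exists l, g. repeat split; auto.
        intros z Hz E. apply H. now exists z. }
      destruct Hz as [a [Har Ha]]. destruct (entire_series_divide g a Hg Ha) as [h [Hh Eh]].
      exists (a :: l), h. repeat split; [exact Hh| |intros b [<-|Hb]; auto|simpl; auto].
      intros z. rewrite Hfg, Eh. simpl. ring. }
  destruct Hf as [a [Ha E]].
  (* [Rmax r 1] supplies a positive radius, since r is arbitrary here. *)
  destruct (CPSeries_bounded a (4 * Rmax r 1) Ha) as [M [_ HM]].
  { generalize (Rmax_r r 1). lra. }
  assert (Hpos : 0 < Cmod (f (RtoC 0))) by now apply Cmod_gt_0.
  (* With n + 1 > M / |f 0|, already n + 1 split-off zeros violate |f 0| 3^(n+1) <= M. *)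
  destruct (nfloor_ex (Rmax 0 (M / Cmod (f (RtoC 0))))) as [n Hn]; [apply Rmax_l|].
  destruct (All (S n)) as [l [g [[Hg [Hfg Hl]] Hlen]]].
  assert (H : Cmod (f (RtoC 0)) * 3 ^ length l <= M).
  { apply (root_count_le f g l (Rmax r 1)); [exact Hg|exact Hfg| | |].
    - generalize (Rmax_r r 1). lra.
    - intros b Hb. generalize (Hl b Hb) (Rmax_l r 1). lra.
    - intros z Hz. rewrite E. apply HM. lra. }
  rewrite Rmult_comm in H. apply Rle_div_r in H; [|lra].
  generalize (le_pow_3 (length l)) (Rmax_r 0 (M / Cmod (f (RtoC 0)))). rewrite Hlen, S_INR in *.
  lra.
Qed.

(** * Newton coefficients of cos (sqrt n) + 2 *)

Fixpoint stirling2 (m k : nat) : R :=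
  match m, k with
  | O, O => 1
  | O, S _ => 0
  | S _, O => 0
  | S m', S k' => stirling2 m' k' + INR (S k') * stirling2 m' (S k')
  end.

Lemma stirling2_SS (m k : nat) : stirling2 (S m) (S k) = stirling2 m k + INR (S k) * stirling2 m (S k).
Proof. reflexivity. Qed.

Lemma stirling2_0 (m k : nat) : (m < k)%nat -> stirling2 m k = 0.
Proof.
  revert k. induction m as [|m IH]; intros [|k] Hk; try lia; [reflexivity|].
  rewrite stirling2_SS, !IH by lia. ring.
Qed.

Lemma stirling2_diag (m : nat) : stirling2 m m = 1.
Proof.
  induction m as [|m IH]; [reflexivity|]. rewrite stirling2_SS, IH, (stirling2_0 m (S m)) by lia.
  ring.
Qed.

Lemma stirling2_pos (m k : nat) : 0 <= stirling2 m k.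
Proof.
  revert k. induction m as [|m IH]; intros [|k]; try (simpl; lra).
  rewrite stirling2_SS.
  generalize (IH k) (Rmult_le_pos _ _ (pos_INR (S k)) (IH (S k))). lra.
Qed.

(* S(k + j, k) is the complete homogeneous polynomial of degree j in 1, ..., k,
   hence at most the j-th power of their sum. *)
Lemma stirling2_le (j k : nat) : stirling2 (k + j) k <= (INR k * INR (S k) / 2) ^ j.
Proof.
  assert (T : forall k, 0 <= INR k * INR (S k) / 2).
  { intros i. generalize (Rmult_le_pos _ _ (pos_INR i) (pos_INR (S i))). lra. }
  revert k. induction j as [|j IHj]; intros k.
  - rewrite Nat.add_0_r, stirling2_diag. simpl. lra.
  - induction k as [|k IHk].
    + simpl stirling2. apply pow_le, T.
    + replace (S k + S j)%nat with (S (k + S j)) by lia. rewrite stirling2_SS.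
      specialize (IHj (S k)). replace (S k + j)%nat with (k + S j)%nat in IHj by lia.
      set (t := INR k * INR (S k) / 2) in *. set (t' := INR (S k) * INR (S (S k)) / 2) in *.
      assert (Et : t' = t + INR (S k)) by (unfold t, t'; rewrite !S_INR; field).
      assert (Ht : 0 <= t) by apply T. assert (Hk := pos_INR (S k)).
      assert (Hp : t ^ j <= t' ^ j) by (apply pow_incr; lra).
      apply Rle_trans with (t * t' ^ j + INR (S k) * t' ^ j).
      * apply Rplus_le_compat; [|apply Rmult_le_compat_l; assumption].
        apply Rle_trans with (1 := IHk). simpl pow. apply Rmult_le_compat_l; assumption.
      * right. simpl pow. rewrite Et at 3. ring.
Qed.

(** Induction on m, multiplying by n = k + (n - k): the factor n - k cancels in (n - k)! and moves
    the term to index k + 1, where the recurrence of the Stirling numbers recombines the two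
    parts. *)
Lemma pow_INR_stirling2 (m n : nat) :
  INR n ^ m / INR (fact n) = sum_f_R0 (fun k => stirling2 m k / INR (fact (n - k))) n.
Proof.
  revert n. induction m as [|m IH]; intros n.
  - destruct n as [|n]; [simpl; field|].
    rewrite decomp_sum by lia.
    rewrite sum_eq_R0; [simpl pow; simpl stirling2; rewrite Nat.sub_0_r; ring|].
    intros k _. simpl stirling2. unfold Rdiv. ring.
  - destruct n as [|p]; [simpl; field|].
    rewrite decomp_sum by lia. simpl (Nat.pred (S p)).
    transitivity (INR (S p) * (INR (S p) ^ m / INR (fact (S p))));
      [rewrite <- tech_pow_Rmult; unfold Rdiv; ring|].
    rewrite IH, scal_sum.
    transitivity (sum_f_R0 (fun k => INR k * stirling2 m k / INR (fact (S p - k))) (S p)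
       + sum_f_R0 (fun k => INR (S p - k) * stirling2 m k / INR (fact (S p - k))) (S p)).
    { rewrite <- plus_sum. apply sum_eq. intros k Hk. rewrite minus_INR by lia. unfold Rdiv. ring. }
    rewrite (decomp_sum (fun k => INR k * stirling2 m k / INR (fact (S p - k)))) by lia.
    rewrite (tech5 (fun k => INR (S p - k) * stirling2 m k / INR (fact (S p - k)))).
    rewrite Nat.sub_diag. simpl (Nat.pred (S p)). simpl (INR 0). simpl (stirling2 (S m) 0).
    transitivity (sum_f_R0 (fun k => INR (S k) * stirling2 m (S k) / INR (fact (S p - S k))) p
       + sum_f_R0 (fun k => INR (S p - k) * stirling2 m k / INR (fact (S p - k))) p);
           [unfold Rdiv; ring|].
    rewrite <- plus_sum. unfold Rdiv at 3. rewrite Rmult_0_l, Rplus_0_l. apply sum_eq. intros k Hk.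
    replace (S p - S k)%nat with (p - k)%nat by lia. replace (S p - k)%nat with (S (p - k)) by lia.
    rewrite fact_simpl, mult_INR, stirling2_SS. field.
    split; [apply INR_fact_neq_0|apply not_0_INR; lia].
Qed.

Lemma Rabs_cos_n (m : nat) : Rabs (cos_n m) = / INR (fact (2 * m)).
Proof.
  unfold cos_n, Rdiv. rewrite Rabs_mult, pow_1_abs, Rmult_1_l.
  apply Rabs_pos_eq. left. apply Rinv_0_lt_compat, INR_fact_lt_0.
Qed.

(** With i = 2(k + j), the step from j to j + 1 multiplies the bound by (k(k + 1)/2) / ((i + 1)(i +
    2)); this is at most 1/8 because i >= 2k. *)
Lemma cos_n_stirling2_le (k j : nat) :
  Rabs (cos_n (k + j) * stirling2 (k + j) k) <= / INR (fact (2 * k)) * (1 / 8) ^ j.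
Proof.
  rewrite Rabs_mult, Rabs_cos_n, (Rabs_pos_eq (stirling2 _ _)) by apply stirling2_pos.
  eapply Rle_trans; [apply Rmult_le_compat_l;
    [left; apply Rinv_0_lt_compat, INR_fact_lt_0|apply stirling2_le]|].
  assert (T : 0 <= INR k * INR (S k) / 2).
  { generalize (Rmult_le_pos _ _ (pos_INR k) (pos_INR (S k))). lra. }
  induction j as [|j IH]; [rewrite Nat.add_0_r; simpl; lra|].
  replace (2 * (k + S j))%nat with (S (S (2 * (k + j)))) by lia.
  set (i := (2 * (k + j))%nat) in *. rewrite !fact_simpl, !mult_INR.
  assert (Hi := INR_fact_lt_0 i).
  assert (Hr : INR k * INR (S k) / 2 <= INR (S (S i)) * INR (S i) * (1 / 8)).
  { unfold i. rewrite !S_INR, mult_INR, plus_INR. simpl (INR 2).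
    generalize (pos_INR k) (pos_INR j). nra. }
  assert (H1 : 0 < INR (S i)) by (apply lt_0_INR; lia).
  assert (H2 : 0 < INR (S (S i))) by (apply lt_0_INR; lia).
  set (t := INR k * INR (S k) / 2) in *.
  replace (/ (INR (S (S i)) * (INR (S i) * INR (fact i))) * t ^ S j)
    with (t / (INR (S (S i)) * INR (S i)) * (/ INR (fact i) * t ^ j)) by (simpl pow; field; lra).
  replace (/ INR (fact (2 * k)) * (1 / 8) ^ S j)
    with (1 / 8 * (/ INR (fact (2 * k)) * (1 / 8) ^ j)) by (simpl pow; ring).
  assert (Hii : 0 < INR (S (S i)) * INR (S i)) by now apply Rmult_lt_0_compat.
  apply Rmult_le_compat; [| |apply Rle_div_l; lra|exact IH].
  - apply Rmult_le_pos; [exact T|left; now apply Rinv_0_lt_compat].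
  - apply Rmult_le_pos; [left; now apply Rinv_0_lt_compat|now apply pow_le].
Qed.

(** The summation starts at m = k, below which S(m, k) = 0, so that the term j = 0 is the dominant
    [cos_n k]. *)
Definition newton_coef (k : nat) : R := Series (fun j => cos_n (k + j) * stirling2 (k + j) k).

Lemma is_Rseries_head (u : nat -> R) (l : R) :
  is_series (fun k => u (S k)) l -> is_series u (u O + l).
Proof.
  intros H. apply is_series_decr_1.
  refine (eq_ind l (is_series (fun k => u (S k))) H _ _).
  change (l = u O + l + - u O). ring.
Qed.

Lemma is_series_newton_coef_shift (k : nat) :
  is_series (fun j => cos_n (k + j) * stirling2 (k + j) k) (newton_coef k).
Proof.
  apply Series_correct.
  apply (ex_series_le (K := R_AbsRing) (V := R_CompleteNormedModule) _ (fun j => / INR (fact (2 * k)) * (1 / 8) ^ j)).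
  - intros j. apply cos_n_stirling2_le.
  - apply (ex_series_scal (K := R_AbsRing) (V := R_NormedModule)), ex_series_geom.
    rewrite Rabs_pos_eq; lra.
Qed.

(** Returns to an index m common to all k, so that the series for different k can be added
    termwise. *)
Lemma is_series_newton_coef (k : nat) :
  is_series (fun m => cos_n m * stirling2 m k) (newton_coef k).
Proof.
  assert (H : forall i u l, (forall m, (m < i)%nat -> u m = 0) ->
     is_series (fun j => u (i + j)%nat) l -> is_series (u : nat -> R) (l : R)).
  { induction i as [|i IH]; intros u l Hu Hl; [exact Hl|].
    replace l with (u O + l) by (rewrite Hu by lia; ring).
    apply is_Rseries_head, IH; [|exact Hl]. intros m Hm. apply Hu. lia. }
  apply (H k); [|apply is_series_newton_coef_shift].
  intros m Hm. rewrite stirling2_0 by exact Hm. ring.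
Qed.

(** The constant is 1/7 = 1/8 + 1/8^2 + ..., the geometric majorant without its term j = 0. *)
Lemma Rabs_newton_coef_minus (k : nat) :
  Rabs (newton_coef k - cos_n k) <= / 7 * / INR (fact (2 * k)).
Proof.
  assert (H := is_series_newton_coef_shift k).
  set (u j := cos_n (k + j) * stirling2 (k + j) k) in *.
  assert (Hu0 : u O = cos_n k) by (unfold u; rewrite Nat.add_0_r, stirling2_diag; ring).
  assert (Ht : is_series (fun j => u (S j)) (newton_coef k - cos_n k)).
  { apply is_series_incr_1. refine (eq_ind _ (is_series u) H _ _).
    change (newton_coef k = newton_coef k - cos_n k + u O). rewrite Hu0. ring. }
  assert (Hg : is_series (fun j => / INR (fact (2 * k)) * (1 / 8) * (1 / 8) ^ j) (/ INR (fact (2 * k)) * (1 / 8) * / (1 - 1 / 8))).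
  { apply (is_series_scal_l (K := R_AbsRing) (V := R_NormedModule)), is_series_geom.
    rewrite Rabs_pos_eq; lra. }
  assert (Hb : forall j, Rabs (u (S j)) <= / INR (fact (2 * k)) * (1 / 8) * (1 / 8) ^ j).
  { intros j. eapply Rle_trans; [apply cos_n_stirling2_le|]. simpl pow. lra. }
  rewrite <- (is_series_unique _ _ Ht).
  eapply Rle_trans; [apply Series_Rabs|].
  - apply (ex_series_le (K := R_AbsRing) (V := R_CompleteNormedModule) _ (fun j => / INR (fact (2 * k)) * (1 / 8) * (1 / 8) ^ j)).
    + intros j. change (Rabs (Rabs (u (S j))) <= / INR (fact (2 * k)) * (1 / 8) * (1 / 8) ^ j).
      rewrite Rabs_Rabsolu. apply Hb.
    + eexists. exact Hg.
  - eapply Rle_trans;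
      [apply (Series_le _ (fun j => / INR (fact (2 * k)) * (1 / 8) * (1 / 8) ^ j))|].
    + intros j. split; [apply Rabs_pos|apply Hb].
    + eexists. exact Hg.
    + rewrite (is_series_unique _ _ Hg). right. field. apply INR_fact_neq_0.
Qed.

(* The Newton coefficients of n |-> cos (sqrt n) + 2; these are the Taylor
   coefficients of G. *)
Definition G_coef (k : nat) : R := newton_coef k + match k with O => 2 | S _ => 0 end.

Lemma is_Rseries_sum_f_R0 (u : nat -> nat -> R) (s : nat -> R) (n : nat) :
  (forall j, is_series (u j) (s j)) -> is_series (fun k => sum_f_R0 (fun j => u j k) n) (sum_f_R0 s n).
Proof.
  intros H. induction n as [|n IH]; [apply H|]. simpl. exact (is_series_plus _ _ _ _ IH (H (S n))).
Qed.

(** Both sides of the cosine part are sums of one series over m, whose terms agree by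
    [pow_INR_stirling2]. The constant 2 enters through k = 0 only, as 2 / n!. *)
Lemma F_coef_newton (n : nat) :
  (cos (sqrt (INR n)) + 2) / INR (fact n) = sum_f_R0 (fun k => G_coef k * / INR (fact (n - k))) n.
Proof.
  transitivity (cos (sqrt (INR n)) / INR (fact n) + 2 / INR (fact n)); [unfold Rdiv; ring|].
  unfold G_coef.
  transitivity (sum_f_R0 (fun k => newton_coef k * / INR (fact (n - k))) n
     + sum_f_R0 (fun k => match k with O => 2 | S _ => 0 end * / INR (fact (n - k))) n).
  2: { rewrite <- plus_sum. apply sum_eq. intros k _. ring. }
  f_equal.
  - assert (H1 : is_series (fun m => / INR (fact n) * (cos_n m * INR n ^ m)) (/ INR (fact n) * cos (sqrt (INR n)))).
    { apply (is_series_scal_l (K := R_AbsRing) (V := R_NormedModule)).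
      assert (H := is_series_cos (sqrt (INR n))). rewrite sqrt_sqrt in H by apply pos_INR.
      exact H. }
    assert (H2 := is_Rseries_sum_f_R0 _ _ n (fun k =>
       is_series_scal_r (/ INR (fact (n - k))) _ _ (is_series_newton_coef k))).
    rewrite <- (is_series_unique _ _ H2). unfold Rdiv.
    rewrite Rmult_comm, <- (is_series_unique _ _ H1).
    apply Series_ext. intros m.
    transitivity (cos_n m * (INR n ^ m / INR (fact n))); [unfold Rdiv; ring|].
    rewrite pow_INR_stirling2, scal_sum. apply sum_eq. intros k _. unfold Rdiv. ring.
  - destruct n as [|n]; [simpl; field|]. rewrite decomp_sum by lia.
    rewrite sum_eq_R0; [|intros k _; ring].
    rewrite Nat.sub_0_r. unfold Rdiv. ring.
Qed.

(** * Comparison of G with the hyperbolic cosine *)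

Lemma is_series_cosh (s : R) : is_series (fun k => (s * s) ^ k / INR (fact (2 * k))) (cosh s).
Proof.
  set (w n := / 2 * (/ INR (fact n) * s ^ n + / INR (fact n) * (- s) ^ n)).
  assert (Hw : is_series w (cosh s)).
  { replace (cosh s) with (/ 2 * (exp s + exp (- s))) by (unfold cosh; field).
    apply (is_series_scal_l (K := R_AbsRing) (V := R_NormedModule)).
    apply (is_series_plus (K := R_AbsRing) (V := R_NormedModule) (fun n => / INR (fact n) * s ^ n) (fun n => / INR (fact n) * (- s) ^ n)); apply is_pseries_R, is_exp_Reals. }
  assert (Ev : forall k, w (2 * k)%nat = (s * s) ^ k / INR (fact (2 * k))).
  { intros k. unfold w. rewrite !pow_mult. replace ((- s) ^ 2) with (s * s) by ring.
    replace (s ^ 2) with (s * s) by ring.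
    field. apply INR_fact_neq_0. }
  assert (Od : forall k, w (S (2 * k)) = 0).
  { intros k. unfold w. rewrite <- !tech_pow_Rmult, !pow_mult.
    replace ((- s) ^ 2) with (s ^ 2) by ring. ring. }
  (* Since the odd terms of w vanish, the series in the claim has a subsequence of the partial sums
     of w as its partial sums. *)
  assert (Hs : forall N, sum_n w (2 * N) = sum_n (fun k => (s * s) ^ k / INR (fact (2 * k))) N).
  { induction N as [|N IH].
    - rewrite Nat.mul_0_r, !sum_O. apply (Ev O).
    - replace (2 * S N)%nat with (S (S (2 * N))) at 1 by lia. rewrite !sum_Sn, IH, Od.
      replace (S (S (2 * N))) with (2 * S N)%nat by lia. rewrite Ev.
      change (sum_n (fun k => (s * s) ^ k / INR (fact (2 * k))) N + 0 + (s * s) ^ S N / INR (fact (2 * S N)) =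
        sum_n (fun k => (s * s) ^ k / INR (fact (2 * k))) N + (s * s) ^ S N / INR (fact (2 * S N))). ring. }
  apply (filterlim_ext (fun N => sum_n w (2 * N)) _ Hs).
  apply (filterlim_comp _ _ _ (fun N => (2 * N)%nat) (sum_n w) eventually eventually); [|exact Hw].
  intros P [N HN]. exists N. intros n Hn. apply HN. lia.
Qed.

Definition G (z : C) : C := CPSeries (fun k => RtoC (G_coef k)) z.

(** The parts contribute 1/7 + 1 + 2 <= 4 in units of 1/(2k)!; the 2 occurs only at k = 0, where
    (2k)! = 1. *)
Lemma G_coef_upper (k : nat) : Rabs (G_coef k) <= 4 / INR (fact (2 * k)).
Proof.
  assert (H := Rabs_newton_coef_minus k). assert (Hc := Rabs_cos_n k).
  assert (Hf : 0 < / INR (fact (2 * k))) by apply Rinv_0_lt_compat, INR_fact_lt_0.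
  assert (Hd : Rabs (match k with O => 2 | S _ => 0 end) <= 2 * / INR (fact (2 * k))).
  { destruct k; [simpl; rewrite Rabs_pos_eq; lra|]. rewrite Rabs_R0. lra. }
  unfold G_coef. replace (newton_coef k) with (newton_coef k - cos_n k + cos_n k) by ring.
  eapply Rle_trans; [apply Rabs_triang|]. eapply Rle_trans; [apply Rplus_le_compat_r, Rabs_triang|].
  unfold Rdiv. lra.
Qed.

(** The sign (-1)^k makes the leading term positive, an error of 1/7 leaves 6/7, and the extra 2 at
    k = 0 is positive as well. *)
Lemma G_coef_lower (k : nat) : 6 / 7 / INR (fact (2 * k)) <= G_coef k * (-1) ^ k.
Proof.
  assert (H := Rabs_newton_coef_minus k).
  assert (Hf : 0 < / INR (fact (2 * k))) by apply Rinv_0_lt_compat, INR_fact_lt_0.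
  assert (Hd : 0 <= match k with O => 2 | S _ => 0 end * (-1) ^ k) by (destruct k; simpl; lra).
  unfold G_coef. rewrite Rmult_plus_distr_r.
  assert (E : newton_coef k * (-1) ^ k = / INR (fact (2 * k)) + (newton_coef k - cos_n k) * (-1) ^ k).
  { assert (H1 : (-1) ^ k * (-1) ^ k = 1) by (rewrite <- Rpow_mult_distr; replace (-1 * -1) with 1 by ring; apply pow1).
    unfold cos_n.
    transitivity (newton_coef k * (-1) ^ k + / INR (fact (2 * k)) * (1 - (-1) ^ k * (-1) ^ k));
      [rewrite H1; ring|].
    unfold Rdiv. rewrite H1 at 1. ring_simplify. nra. }
  assert (Ha : Rabs ((newton_coef k - cos_n k) * (-1) ^ k) <= / 7 * / INR (fact (2 * k))).
  { rewrite Rabs_mult, pow_1_abs, Rmult_1_r. exact H. }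
  apply Rabs_le_between in Ha. rewrite E. unfold Rdiv. lra.
Qed.

Lemma cosh_le_exp (s : R) : 0 <= s -> cosh s <= exp s.
Proof.
  intros Hs. unfold cosh. assert (exp (- s) <= exp s); [|lra].
  destruct (Req_dec s 0) as [->|]; [rewrite Ropp_0; lra|left; apply exp_increasing; lra].
Qed.

Lemma rapid_G_coef : rapid (fun k => RtoC (G_coef k)).
Proof.
  intros r Hr. exists (4 * cosh (sqrt r)). intros k. rewrite Cmod_R.
  assert (Hf : 0 < / INR (fact (2 * k))) by apply Rinv_0_lt_compat, INR_fact_lt_0.
  apply Rle_trans with (4 * (r ^ k / INR (fact (2 * k)))).
  - replace (4 * (r ^ k / INR (fact (2 * k)))) with (4 / INR (fact (2 * k)) * r ^ k) by (unfold Rdiv; ring).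
    apply Rmult_le_compat_r; [apply pow_le; lra|apply G_coef_upper].
  - apply Rmult_le_compat_l; [lra|]. assert (H := is_series_cosh (sqrt r)).
    rewrite sqrt_sqrt in H by lra.
    apply (series_term_le _ _ k) in H; [exact H|]. intros n.
    apply Rmult_le_pos; [apply pow_le; lra|left; apply Rinv_0_lt_compat, INR_fact_lt_0].
Qed.

Lemma Cmod_G_le (z : C) : Cmod (G z) <= 4 * exp (sqrt (Cmod z)).
Proof.
  apply Rle_trans with (4 * cosh (sqrt (Cmod z))).
  2: { apply Rmult_le_compat_l; [lra|]. apply cosh_le_exp, sqrt_pos. }
  assert (H := is_series_scal_l (K := R_AbsRing) (V := R_NormedModule) 4 _ _ (is_series_cosh (sqrt (Cmod z)))).
  refine (is_Cseries_Cmod_le _ _ _ _ _ (CPSeries_correct _ z rapid_G_coef) H).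
  intros k. rewrite sqrt_sqrt by apply Cmod_ge_0. rewrite Cmod_mult, Cmod_pow, Cmod_R.
  change (Rabs (G_coef k) * Cmod z ^ k <= 4 * (Cmod z ^ k / INR (fact (2 * k)))).
  replace (4 * (Cmod z ^ k / INR (fact (2 * k)))) with (4 / INR (fact (2 * k)) * Cmod z ^ k) by (unfold Rdiv; ring).
  apply Rmult_le_compat_r; [apply pow_le, Cmod_ge_0|apply G_coef_upper].
Qed.

(* On the negative axis all the terms of the series of G are positive. *)
Lemma Cmod_G_neg_ge (r : R) : 0 <= r -> 3 / 7 * exp (sqrt r) <= Cmod (G (RtoC (- r))).
Proof.
  intros Hr. eapply Rle_trans; [|apply re_le_Cmod]. eapply Rle_trans; [|apply Rle_abs].
  assert (H := CPSeries_correct _ (RtoC (- r)) rapid_G_coef). apply is_Cseries_components in H.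
  destruct H as [H _]. fold (G (RtoC (- r))) in H.
  assert (Hc := is_series_scal_l (K := R_AbsRing) (V := R_NormedModule) (6 / 7) _ _ (is_series_cosh (sqrt r))).
  rewrite sqrt_sqrt in Hc by exact Hr.
  apply Rle_trans with (6 / 7 * cosh (sqrt r)).
  { unfold cosh. generalize (exp_pos (- sqrt r)). lra. }
  apply (filterlim_le (F := eventually) _ _ (Finite (6 / 7 * cosh (sqrt r))) (Finite (Re (G (RtoC (- r)))))) with (2 := Hc) (3 := H).
  exists O. intros n _. apply sum_n_m_le. intros k. rewrite <- RtoC_pow, <- RtoC_mult, re_RtoC.
  change (6 / 7 * (r ^ k / INR (fact (2 * k))) <= G_coef k * (- r) ^ k).
  replace (- r) with (-1 * r) by ring. rewrite Rpow_mult_distr.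
  replace (6 / 7 * (r ^ k / INR (fact (2 * k)))) with (6 / 7 / INR (fact (2 * k)) * r ^ k) by (unfold Rdiv; ring).
  rewrite <- Rmult_assoc. apply Rmult_le_compat_r; [now apply pow_le|apply G_coef_lower].
Qed.

Lemma F_coef_Cconv (n : nat) : Cconv (fun k => RtoC (G_coef k)) exp_coef n = F_coef n.
Proof.
  unfold F_coef. rewrite F_coef_newton. unfold Cconv, exp_coef. generalize n at 2 4. intros m.
  induction m as [|m IH]; [rewrite Csum_n_O; simpl; now rewrite RtoC_mult|].
  rewrite Csum_n_Sn, IH. simpl sum_f_R0. now rewrite RtoC_plus, RtoC_mult.
Qed.

Lemma rapid_F_coef : rapid F_coef.
Proof.
  intros r Hr. destruct (rapid_conv _ _ rapid_G_coef rapid_exp_coef r Hr) as [M HM]. exists M.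
  intros k. rewrite <- F_coef_Cconv. apply HM.
Qed.

Lemma F_factorization (z : C) : F z = Cmult (Cexp z) (G z).
Proof.
  rewrite Cexp_CPSeries, Cmult_comm. unfold G.
  rewrite <- CPSeries_mult by (apply rapid_G_coef || apply rapid_exp_coef).
  apply CPSeries_unique.
  eapply is_series_ext; [|apply CPSeries_correct, rapid_conv;
    [apply rapid_G_coef|apply rapid_exp_coef]].
  intros n. cbv beta. now rewrite F_coef_Cconv.
Qed.

(** * Growth, zeros and the theorem *)

(** The point on the circle rules out [m_infty] and the bound M rules out [p_infty], so [real]
    returns the true supremum and not its default value. *)
Lemma max_modulus_between (f : C -> C) (r m M : R) :
  (exists z, Cmod z = r /\ m <= Cmod (f z)) -> (forall z, Cmod z = r -> Cmod (f z) <= M) ->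
  m <= max_modulus f r <= M.
Proof.
  intros [z [Hz Hm]] HM. unfold max_modulus.
  set (A := fun y => exists z, Cmod z = r /\ y = Cmod (f z)).
  destruct (Lub_Rbar_correct A) as [Hub Hlub].
  assert (H1 := Hub (Cmod (f z)) (ex_intro _ z (conj Hz eq_refl))).
  assert (H2 : Rbar_le (Lub_Rbar A) M).
  { apply Hlub. intros y [w [Hw ->]]. now apply HM. }
  destruct (Lub_Rbar A) as [l| |]; simpl in *; [lra|tauto|tauto].
Qed.

Lemma exp_1_ge : 2 <= exp 1.
Proof. generalize (exp_ineq1_le 1). lra. Qed.

Lemma max_modulus_G_bounds (r : R) : 0 <= r ->
  3 / 7 * exp (sqrt r) <= max_modulus G r <= 4 * exp (sqrt r).
Proof.
  intros Hr. apply max_modulus_between.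
  - exists (RtoC (- r)). split; [rewrite Cmod_R, Rabs_Ropp, Rabs_pos_eq; lra|].
    now apply Cmod_G_neg_ge.
  - intros z <-. apply Cmod_G_le.
Qed.

(** The constants come from ln x <= x - 1 at x = 7/3 and x = 4. *)
Lemma ln_max_modulus_G_bounds (r : R) : 0 <= r ->
  sqrt r - 4 / 3 <= ln (max_modulus G r) <= sqrt r + 3.
Proof.
  intros Hr. destruct (max_modulus_G_bounds r Hr) as [H1 H2].
  assert (He := exp_pos (sqrt r)).
  assert (Hln : forall c, 0 < c -> ln (c * exp (sqrt r)) = ln c + sqrt r).
  { intros c Hc. rewrite ln_mult, ln_exp by assumption. reflexivity. }
  assert (Hup : forall x, 0 < x -> ln x <= x - 1).
  { intros x Hx. rewrite <- (ln_exp (x - 1)). apply ln_le; [exact Hx|].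
    generalize (exp_ineq1_le (x - 1)). lra. }
  split.
  - apply Rle_trans with (ln (3 / 7 * exp (sqrt r))); [|apply ln_le; lra].
    rewrite Hln by lra. replace (3 / 7) with (/ (7 / 3)) by field. rewrite ln_Rinv by lra.
    generalize (Hup (7 / 3) ltac:(lra)). lra.
  - apply Rle_trans with (ln (4 * exp (sqrt r))); [apply ln_le; lra|].
    rewrite Hln by lra. generalize (Hup 4 ltac:(lra)). lra.
Qed.

Lemma order_half_mean_type_G : order_half_mean_type G.
Proof.
  unfold order_half_mean_type.
  set (f := fun r => / sqrt r * ln (max_modulus G r)). unfold limsup_infty.
  set (T := fun s => exists r : R, s = Lub_Rbar (fun y => exists x, r <= x /\ y = f x)).
  assert (Hsqrt : forall x, 1 <= x -> 1 <= sqrt x).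
  { intros x Hx. rewrite <- sqrt_1. apply sqrt_le_1; lra. }
  destruct (Rbar_ex_glb T) as [s0 Hs0]. rewrite (Rbar_is_glb_unique _ _ Hs0).
  destruct Hs0 as [Hlb Hglb].
  split.
  - apply Rbar_lt_le_trans with (Finite (1 / 3)); [simpl; lra|].
    apply Hglb. intros s [r ->].
    (* Each tail contains a point x with sqrt x >= 2, where 1 - (4/3) / sqrt x >= 1/3. *)
    set (x := Rmax r 4). assert (Hx4 : 4 <= x) by apply Rmax_r.
    apply Rbar_le_trans with (Finite (f x)).
    + assert (Hx : 2 <= sqrt x).
      { replace 2 with (sqrt 4) by (replace 4 with (2 * 2) by lra; apply sqrt_square; lra).
        apply sqrt_le_1; lra. }
      destruct (ln_max_modulus_G_bounds x) as [H _]; [lra|].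
      change (1 / 3 <= / sqrt x * ln (max_modulus G x)). rewrite (Rmult_comm (/ sqrt x)).
      apply -> Rle_div_r; lra.
    + destruct (Lub_Rbar_correct (fun y => exists x, r <= x /\ y = f x)) as [Hub _].
      apply Hub. exists x. split; [apply Rmax_l|reflexivity].
  - apply Rbar_le_lt_trans with (Finite 4); [|exact I].
    (* On the tail from 1 on, 1 + 3 / sqrt x <= 4. *)
    eapply Rbar_le_trans; [apply Hlb; exists 1; reflexivity|].
    destruct (Lub_Rbar_correct (fun y => exists x, 1 <= x /\ y = f x)) as [_ Hlub].
    apply Hlub. intros y [x [Hx ->]]. change (/ sqrt x * ln (max_modulus G x) <= 4).
    destruct (ln_max_modulus_G_bounds x) as [_ H]; [lra|]. specialize (Hsqrt x Hx).
    rewrite (Rmult_comm (/ sqrt x)). apply Rle_div_l; lra.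
Qed.

Lemma entire_series_G : entire_series G.
Proof. eexists. split; [exact rapid_G_coef|reflexivity]. Qed.

Lemma entire_series_F : entire_series F.
Proof. exists F_coef. split; [exact rapid_F_coef|reflexivity]. Qed.

Lemma Cmod_G_0 : 2 <= Cmod (G (RtoC 0)) <= 4.
Proof.
  unfold G. rewrite CPSeries_at_0, Cmod_R.
  assert (Hu := G_coef_upper 0). simpl in Hu. split; [|lra].
  eapply Rle_trans; [|apply Rle_abs].
  assert (H := Rabs_newton_coef_minus 0). apply Rabs_le_between in H.
  unfold cos_n in H. simpl in H. unfold G_coef. lra.
Qed.

(** From 2 * 3^n <= 4 exp (2 sqrt r) and exp 1 <= 3 comes exp n <= 2 exp (2 sqrt r) <= exp (1 + 2
    sqrt r), so n <= 1 + 2 sqrt r; the 1 is absorbed for r >= 1. *)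
Lemma zero_count_F (r : R) : exists n, zero_count F r n /\ (1 <= r -> INR n <= 3 * sqrt r).
Proof.
  assert (HG0 := Cmod_G_0).
  destruct (entire_series_split_zeros G r entire_series_G) as [l [g [Hg [HGg [Hl Hz]]]]].
  { apply Cmod_gt_0. lra. }
  exists (length l). split.
  - apply (zero_count_of_factorization F (fun z => Cmult (Cexp z) (g z))).
    + apply entire_series_mult; [apply entire_series_Cexp|exact Hg].
    + intros z. rewrite F_factorization, HGg. ring.
    + exact Hl.
    + intros z Hzr. apply Cmult_neq_0; [|now apply Hz]. apply Cmod_gt_0. rewrite Cmod_Cexp.
      apply exp_pos.
  - intros Hr. assert (Hs : 1 <= sqrt r) by (rewrite <- sqrt_1; apply sqrt_le_1; lra).
    assert (H : Cmod (G (RtoC 0)) * 3 ^ length l <= 4 * exp (2 * sqrt r)).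
    { apply (root_count_le G g l r); [exact Hg|exact HGg|lra|exact Hl|].
      intros z Hz4. eapply Rle_trans; [apply Cmod_G_le|]. rewrite Hz4, sqrt_mult by lra.
      replace (sqrt 4) with 2; [lra|]. replace 4 with (2 * 2) by lra. symmetry. apply sqrt_square.
      lra. }
    assert (He : exp (INR (length l)) <= 3 ^ length l).
    { rewrite <- (Rmult_1_r (INR _)), <- Rpower_pow by lra. unfold Rpower.
      assert (H1 : 1 <= ln 3).
      { rewrite <- (ln_exp 1). apply ln_le; [apply exp_pos|apply exp_le_3]. }
      assert (H2 := Rmult_le_compat_l _ _ _ (pos_INR (length l)) H1).
      destruct (Rle_lt_or_eq_dec _ _ H2) as [H3|H3];
        [left; now apply exp_increasing|right; now rewrite H3]. }
    assert (H3 : exp (INR (length l)) <= exp (1 + 2 * sqrt r)).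
    { rewrite exp_plus. assert (H3 := pow_le 3 (length l) ltac:(lra)).
      assert (H4 := exp_1_ge). assert (H5 := exp_pos (2 * sqrt r)). 
      apply Rle_trans with (1 := He).
      apply Rle_trans with (2 * exp (2 * sqrt r)); [|apply Rmult_le_compat_r; lra].
      assert (H6 := Rmult_le_compat_r _ _ _ H3 (proj1 HG0)). lra. }
    assert (INR (length l) <= 1 + 2 * sqrt r); [|lra].
    apply Rnot_lt_le. intros Hlt. apply exp_increasing in Hlt. lra.
Qed.

(* On the negative axis |Theta e^(alpha z) / e^z| = |Theta| e^(w r) with w real;
   the lower bound on |G| forces 0 < w and the upper bound excludes it. *)
Lemma F_not_exponential :
  ~ (exists Theta alpha : C, forall z : C, F z = Cmult Theta (Cexp (Cmult alpha z))).
Proof.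
  intros [Theta [alpha H]].
  set (w := 1 - Re alpha).
  assert (Hexp : forall r, Cmod (G (RtoC (- r))) = Cmod Theta * exp (w * r)).
  { intros r. assert (E := f_equal Cmod (H (RtoC (- r)))).
    rewrite F_factorization, !Cmod_mult, !Cmod_Cexp in E.
    rewrite re_RtoC, re_scal_r in E. replace (w * r) with (Re alpha * - r + r) by (unfold w; ring).
    rewrite exp_plus, <- Rmult_assoc, <- E. 
    transitivity (Cmod (G (RtoC (- r))) * (exp (- r) * exp r)); [|ring].
    rewrite <- exp_plus, Rplus_opp_l, exp_0. ring. }
  assert (HT : 2 <= Cmod Theta <= 4).
  { assert (E := Hexp 0). rewrite Rmult_0_r, exp_0, Ropp_0, Rmult_1_r in E. rewrite <- E.
    apply Cmod_G_0. }
  destruct (Rle_or_lt w 0) as [Hw|Hw].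
  (* At r = 16 the lower bound is at least (3/7) * 16 > 4, whereas |Theta| e^(16 w) <= 4. *)
  - assert (H1 := Cmod_G_neg_ge 16 ltac:(lra)). rewrite Hexp in H1.
    replace (sqrt 16) with 4 in H1 by (replace 16 with (4 * 4) by lra; symmetry; apply sqrt_square; lra).
    assert (H2 : exp (w * 16) <= 1).
    { destruct (Req_dec w 0) as [->|Hw0]; [rewrite Rmult_0_l, exp_0; lra|].
      rewrite <- exp_0. left. apply exp_increasing. lra. }
    assert (H3 : 16 <= exp 4).
    { replace 4 with (1 + 1 + (1 + 1)) by lra. rewrite !exp_plus. generalize exp_1_ge. intros He.
      assert (4 <= exp 1 * exp 1) by nra. nra. }
    assert (H4 := exp_pos (w * 16)). nra.
  (* Chosen so that w s^2 = s + 1 + w: at r = s^2 the factor exp s cancels and leaves |Theta| exp (1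
     + w) <= 4, against |Theta| >= 2 and exp (1 + w) > 2. *)
  - set (s := 1 / w + 1).
    assert (Hs : 0 < s) by (unfold s; generalize (Rdiv_lt_0_compat 1 w ltac:(lra) Hw); lra).
    assert (H1 := Cmod_G_le (RtoC (- (s * s)))).
    rewrite Hexp, Cmod_R, Rabs_Ropp, Rabs_pos_eq in H1 by (apply Rmult_le_pos; lra).
    rewrite sqrt_square in H1 by lra.
    replace (w * (s * s)) with (1 + w + s) in H1 by (unfold s; field; lra).
    rewrite exp_plus in H1. rewrite <- Rmult_assoc in H1.
    apply Rmult_le_reg_r in H1; [|apply exp_pos]. generalize (exp_ineq1_le (1 + w)). intros H2. nra.
Qed.

Theorem mainTheorem4 :
  (forall z : C, is_pseries (K := C_AbsRing) (V := C_NormedModule) F_coef z (F z)) /\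
  entire F /\
  (exists G : C -> C,
     entire G /\ order_half_mean_type G /\
     forall z : C, F z = Cmult (Cexp z) (G z)) /\
  (exists nF : R -> nat,
     (forall r : R, zero_count F r (nF r)) /\
     exists K r0 : R, forall r : R, (r0 <= r)%R -> (INR (nF r) <= K * sqrt r)%R) /\
  ~ (exists Theta alpha : C, forall z : C,
       F z = Cmult Theta (Cexp (Cmult alpha z))).
Proof.
  split; [|split; [|split; [|split]]].
  - intros z. apply is_Cpseries_iff, CPSeries_correct, rapid_F_coef.
  - apply entire_series_entire, entire_series_F.
  - exists G. split; [apply entire_series_entire, entire_series_G|].
    split; [apply order_half_mean_type_G|apply F_factorization].
  - set (nF r := constructive_indefinite_description _ (zero_count_F r)).
    exists (fun r => proj1_sig (nF r)). split; [intros r; apply (proj2_sig (nF r))|].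
    exists 3, 1. intros r Hr. now apply (proj2_sig (nF r)).
  - apply F_not_exponential.
Qed.
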